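(* Let $n\ge 1$ be an integer, and let $U$ be a fixed optimal oracle prefix-free Turing machine whose outputs are rational closed balls in $\mathbb R^n$, with associated ball complexity $K^A(x;r)$. For every nonempty $E\subseteq\mathbb R^n$, \[ \dim_H(E)=\min_{A\subseteq\omega}\ \sup_{x\in E}\ \liminf_{r\to\infty}\frac{K^A(x;r)}{r}, \qquad \dim_P(E)=\min_{A\subseteq\omega}\ \sup_{x\in E}\ \limsup_{r\to\infty}\frac{K^A(x;r)}{r}, \] with both minima attained.
   Context: $\omega=\{0,1,2,\dots\}$; $2^{<\omega}$ is the set of finite binary strings, $|p|$ the length of $p$. A set of strings is prefix-free if no element is a proper prefix of another. A rational closed ball is a closed ball $\overline B(q,\rho)\subseteq\mathbb R^n$ with $q\in\mathbb Q^n$, $\rho\in\mathbb Q_{>0}$ (finitely coded in a standard computable way). An oracle prefix-free Turing machine $M$ is an oracle Turing machine with inputs in $2^{<\omega}$ such that for every oracle $A\subseteq\omega$ the domain of the partial function $M^A$ is prefix-free. For such an $M$ with outputs rational closed balls put $K_M^A(b)=\min\{|p|:M^A(p)=b\}$ ($\infty$ if no such $p$). $U$ is optimal if for every oracle prefix-free Turing machine $M$ with rational closed balls as outputs there is a constant $c_M$ such that $K_U^A(b)\le K_M^A(b)+c_M$ for every oracle $A$ and every rational closed ball $b$. For an oracle $A\subseteq\omega$, $x\in\mathbb R^n$, $r\in\omega$, \[ K^A(x;r)=\min\{|p|:p\in\operatorname{dom}(U^A),\ x\in U^A(p),\ \operatorname{diam}(U^A(p))\le2^{-r}\}. \] Hausdorff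 dimension: $\mathcal H^s_\delta(E)$ is the infimum of $\sum_i(\operatorname{diam}U_i)^s$ over finite or countable covers $(U_i)$ of $E$ with $0<\operatorname{diam}U_i\le\delta$; $\mathcal H^s(E)=\lim_{\delta\to0}\mathcal H^s_\delta(E)$; $\dim_H(E)=\inf\{s\ge0:\mathcal H^s(E)=0\}$. Packing dimension: a $\delta$-packing of $E$ is a finite or countable, possibly empty, family of pairwise disjoint closed balls of positive radius at most $\delta$ with centers in $E$; $\mathcal P^s_\delta(E)$ is the supremum of $\sum_i(\operatorname{diam}B_i)^s$ over $\delta$-packings $(B_i)$ of $E$; $\mathcal P^s_0(E)=\lim_{\delta\to0}\mathcal P^s_\delta(E)$; $\mathcal P^s(E)=\inf\{\sum_{j\ge1}\mathcal P^s_0(E_j):E\subseteq\bigcup_{j\ge1}E_j\}$; $\dim_P(E)=\inf\{s\ge0:\mathcal P^s(E)=0\}$. *)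

(* Defs.v *)
From HB Require Import structures.
From mathcomp Require Import all_boot all_order all_algebra.
From mathcomp Require Import all_classical all_reals all_analysis.
Set Implicit Arguments.
Unset Strict Implicit.
Unset Printing Implicit Defensive.
Import Order.TTheory GRing.Theory Num.Theory.
Import numFieldNormedType.Exports.
Local Open Scope classical_set_scope.
Local Open Scope ring_scope.

(** * Oracle Turing machines

    Deterministic multi-tape machines with two-way infinite read/write tapes
    whose cells are indexed by [int], together with a read-only oracle tape
    carrying the characteristic function of the oracle on the nonnegative cells
    (and blank on the negative ones). *)

Inductive move := MoveLeft | Stay | MoveRight.

Definition shift_head (m : move) (i : int) : int :=
  match m with MoveLeft => i - 1 | Stay => i | MoveRight => i + 1 end.

(* [None] is the blank, [Some (inl b)] the bit [b], [Some (inr a)] an auxiliary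
   symbol. *)
Definition tape_symbol (aux : finType) := option (bool + aux).

(* There are [otm_work.+2] read/write tapes: tape [ord0] receives the input and
   tape [ord_max] the output. The transition function reads the state, the
   oracle cell under the oracle head and the scanned symbols; all its arguments
   range over finite types, so it is a finite table. *)
Record otm := Otm {
  otm_work : nat;
  otm_aux : finType;
  otm_state : finType;
  otm_start : otm_state;
  otm_halt : pred otm_state;
  otm_delta : otm_state -> option bool ->
    {ffun 'I_otm_work.+2 -> tape_symbol otm_aux} ->
    otm_state * move * {ffun 'I_otm_work.+2 -> tape_symbol otm_aux * move}
}.

Definition tape (aux : finType) := int -> tape_symbol aux.

Definition tape_of_word (aux : finType) (w : bitseq) : tape aux :=
  fun i => match i with
           | Posz k => omap inl (onth w k)
           | Negz _ => None
           end.

Record config (M : otm) := Config {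
  cfg_state : otm_state M;
  cfg_oracle_head : int;
  cfg_head : 'I_(otm_work M).+2 -> int;
  cfg_tape : 'I_(otm_work M).+2 -> tape (otm_aux M)
}.

Definition oracle_cell (A : set nat) (i : int) : option bool :=
  match i with Posz m => Some `[< A m >] | Negz _ => None end.

Definition init_config (M : otm) (p : bitseq) : config M :=
  @Config M (otm_start M) 0 (fun=> 0)
    (fun j => tape_of_word (otm_aux M) (if j == ord0 then p else [::])).

Definition step (M : otm) (A : set nat) (c : config M) : config M :=
  if otm_halt (cfg_state c) then c else
  let: (q, mo, act) :=
    otm_delta (cfg_state c) (oracle_cell A (cfg_oracle_head c))
      [ffun j => cfg_tape c j (cfg_head c j)] in
  @Config M q (shift_head mo (cfg_oracle_head c))
    (fun j => shift_head (act j).2 (cfg_head c j))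
    (fun j i => if i == cfg_head c j then (act j).1 else cfg_tape c j i).

(* [M] with oracle [A] halts on input [p] in the configuration [c] *)
Definition halts_in (M : otm) (A : set nat) (p : bitseq) (c : config M) : Prop :=
  exists2 t : nat, iter t (step A) (init_config M p) = c & otm_halt (cfg_state c).

Definition otm_dom (M : otm) (A : set nat) : set bitseq :=
  [set p | exists c : config M, halts_in A p c].

(* the whole content of the output tape is the word [w] *)
Definition outputs_word (M : otm) (A : set nat) (p w : bitseq) : Prop :=
  exists2 c : config M, halts_in A p c &
    cfg_tape c ord_max =1 tape_of_word (otm_aux M) w.

Definition prefix_free (S : set bitseq) : Prop :=
  forall p q, S p -> S q -> prefix p q -> p = q.

Definition oracle_prefix_free (M : otm) : Prop :=
  forall A : set nat, prefix_free (otm_dom M A).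

(** * Rational closed balls and their codes *)

(* For [n >= 1] a closed ball of positive radius determines its center and its
   radius, so rational closed balls are represented by this data. *)
Record rat_ball (n : nat) := RatBall {
  rb_center : 'rV[rat]_n;
  rb_radius : rat;
  rb_radius_gt0 : 0 < rb_radius
}.

Definition code_nat (m : nat) : bitseq := rcons (nseq m true) false.
Definition code_int (z : int) : bitseq := (z < 0) :: code_nat `|z|%N.
Definition code_rat (q : rat) : bitseq := code_int (numq q) ++ code_int (denq q).
Definition code_ball (n : nat) (b : rat_ball n) : bitseq :=
  flatten [seq code_rat (rb_center b ord0 i) | i <- enum 'I_n]
  ++ code_rat (rb_radius b).

Definition outputs_ball (n : nat) (M : otm) (A : set nat) (p : bitseq)
  (b : rat_ball n) : Prop := outputs_word M A p (code_ball b).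

(* oracle prefix-free machines all of whose outputs are rational closed balls *)
Definition ball_machine (n : nat) (M : otm) : Prop :=
  oracle_prefix_free M /\
  forall (A : set nat) (p : bitseq), otm_dom M A p ->
    exists b : rat_ball n, outputs_ball M A p b.

(** * Euclidean space *)

(* The norm the library puts on ['rV[R]_n] is the sup norm, hence the
   following. *)
Definition eucl_dist (R : realType) (n : nat) (x y : 'rV[R]_n) : R :=
  Num.sqrt (\sum_(i < n) (x ord0 i - y ord0 i) ^+ 2).

Definition eucl_cball (R : realType) (n : nat) (c : 'rV[R]_n) (r : R) :
  set 'rV[R]_n := [set x | eucl_dist c x <= r].

Definition eucl_diam (R : realType) (n : nat) (S : set 'rV[R]_n) : \bar R :=
  ereal_sup [set d | exists x y, [/\ S x, S y & d = (eucl_dist x y)%:E]].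

Definition ball_set (R : realType) (n : nat) (b : rat_ball n) : set 'rV[R]_n :=
  eucl_cball (map_mx ratr (rb_center b)) (ratr (rb_radius b)).
Arguments ball_set R {n} b.

(** * Complexities *)

Local Open Scope ereal_scope.

(* The least length of a string in [S], and [+oo] if [S] is empty: the infimum
   of a nonempty set of natural numbers is its minimum. *)
Definition min_length (R : realType) (S : set bitseq) : \bar R :=
  ereal_inf [set ((size p)%:R)%:E | p in S].

Definition ball_K (R : realType) (n : nat) (M : otm) (A : set nat)
  (b : rat_ball n) : \bar R := min_length R [set p | outputs_ball M A p b].

Definition optimal (R : realType) (n : nat) (U : otm) : Prop :=
  ball_machine n U /\
  forall M : otm, ball_machine n M ->
    exists c : nat, forall (A : set nat) (b : rat_ball n),
      ball_K R U A b <= ball_K R M A b + (c%:R)%:E.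

Definition point_K (R : realType) (n : nat) (U : otm) (A : set nat)
  (x : 'rV[R]_n) (r : nat) : \bar R :=
  min_length R [set p | exists b : rat_ball n,
    [/\ outputs_ball U A p b, ball_set R b x &
        eucl_diam (ball_set R b) <= ((2%:R ^- r)%R)%:E]].

(* [K^A(x;r) / r] as a sequence in [r] (its value at [r = 0] is immaterial) *)
Definition point_K_ratio (R : realType) (n : nat) (U : otm) (A : set nat)
  (x : 'rV[R]_n) : nat -> \bar R :=
  fun r => point_K U A x r * ((r%:R^-1)%R)%:E.

(** * Hausdorff and packing dimensions

    Finite or countable families are families indexed by a set [D] of natural
    numbers. *)

Definition hausdorff_content (R : realType) (n : nat) (s : R)
  (E : set 'rV[R]_n) (delta : R) : \bar R :=
  ereal_inf [set v | exists (D : set nat) (V : nat -> set 'rV[R]_n),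
    [/\ E `<=` \bigcup_(i in D) V i,
        forall i, D i -> 0 < eucl_diam (V i) <= delta%:E &
        v = \esum_(i in D) (eucl_diam (V i) `^ s)]].

Definition hausdorff_measure (R : realType) (n : nat) (s : R)
  (E : set 'rV[R]_n) : \bar R :=
  lim (hausdorff_content s E delta @[delta --> (0%R : R)^'+]).

Definition hausdorff_dim (R : realType) (n : nat) (E : set 'rV[R]_n) : \bar R :=
  ereal_inf [set s%:E | s in [set s : R | (0 <= s)%R /\
                                hausdorff_measure s E = 0]].

Definition packing_content (R : realType) (n : nat) (s : R)
  (E : set 'rV[R]_n) (delta : R) : \bar R :=
  ereal_sup [set v | exists (D : set nat) (c : nat -> 'rV[R]_n) (r : nat -> R),
    [/\ forall i, D i -> E (c i) /\ (0 < r i <= delta)%R,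
        trivIset D (fun i => eucl_cball (c i) (r i)) &
        v = \esum_(i in D) (eucl_diam (eucl_cball (c i) (r i)) `^ s)]].

Definition packing_premeasure (R : realType) (n : nat) (s : R)
  (E : set 'rV[R]_n) : \bar R :=
  lim (packing_content s E delta @[delta --> (0%R : R)^'+]).

Definition packing_measure (R : realType) (n : nat) (s : R)
  (E : set 'rV[R]_n) : \bar R :=
  ereal_inf [set v | exists F : nat -> set 'rV[R]_n,
    E `<=` \bigcup_j F j /\ v = \sum_(0 <= j <oo) packing_premeasure s (F j)].

Definition packing_dim (R : realType) (n : nat) (E : set 'rV[R]_n) : \bar R :=
  ereal_inf [set s%:E | s in [set s : R | (0 <= s)%R /\
                                packing_measure s E = 0]].

Definition is_min (R : realType) (T : Type) (f : T -> \bar R) (m : \bar R) : Prop :=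
  (exists t, f t = m) /\ forall t, m <= f t.

(* Main.v *)
(* Lower bounds. Fix A. If every x in E has liminf K^A(x;r)/r < s0 < s, then for
   each large N the balls U^A(p) with diam <= 2^-r and |p| < s0 r for some r >= N
   cover E, and their s-th powers of diameters sum to at most
   2^(-N(s-s0)) sum_p 2^-|p| <= 2^(-N(s-s0)) by Kraft's inequality. For packings,
   decompose E according to the threshold after which K^A(x;r) < s0 r; a packing
   ball of radius between 2^-r and 2^(1-r) contains the output of a short program
   covering its center, and disjoint balls get distinct programs.

   Upper bounds. A summable family of weights on rational balls is, up to a
   constant, dominated by 2^-K^A for some oracle A: choose a prefix code with
   |sigma_i| <= -log w_i + O(1) (Shannon-Fano-Elias) and let A list the pairs
   (sigma_i, tau_i), where U computes the i-th ball from tau_i without oracle. A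
   lookup machine compares its input with sigma_0, sigma_1, ..., and on equality
   runs U on tau_i; it diverges as soon as the input and sigma_i are comparable
   but distinct, hence is prefix-free whatever the oracle. For Hausdorff dimension
   the weights are diam^s over fine covers with small H^s-sums, for packing
   dimension they come from maximal separated sets at every scale, for a countable
   family of pieces of finite packing premeasure. *)

Require Import Defs.
From HB Require Import structures.
From mathcomp Require Import all_boot all_order all_algebra.
From mathcomp Require Import all_classical all_reals all_analysis.
From mathcomp Require Import zify ring lra.
Set Implicit Arguments.
Unset Strict Implicit.
Unset Printing Implicit Defensive.
Import Order.TTheory GRing.Theory Num.Theory.
Import numFieldNormedType.Exports.
Local Open Scope classical_set_scope.
Local Open Scope ring_scope.

(** * Runs of machines *)

Definition reach (M : otm) (A : set nat) (c c' : config M) : Prop :=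
  exists t, iter t (step A) c = c'.

Lemma reach_refl (M : otm) (A : set nat) (c : config M) : reach A c c.
Proof. by exists 0%N. Qed.

Lemma reach_trans (M : otm) (A : set nat) (c2 c1 c3 : config M) :
  reach A c1 c2 -> reach A c2 c3 -> reach A c1 c3.
Proof. by move=> [t <-] [u <-]; exists (u + t)%N; rewrite iterD. Qed.

Lemma reach_step (M : otm) (A : set nat) (c c' : config M) :
  reach A (step A c) c' -> reach A c c'.
Proof. by apply: reach_trans; exists 1%N. Qed.

Lemma halt_iter (M : otm) (A : set nat) (c : config M) (t : nat) :
  otm_halt (cfg_state c) -> iter t (step A) c = c.
Proof. by move=> hc; elim: t => //= t ->; rewrite /step hc. Qed.

Lemma halts_in_inj (M : otm) (A : set nat) (p : bitseq) (c c' : config M) :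
  halts_in A p c -> halts_in A p c' -> c = c'.
Proof.
move=> [t et hc] [t' et' hc'].
rewrite -(halt_iter A t' hc) -(halt_iter A t hc') -et -et' -!iterD.
by rewrite addnC.
Qed.

Lemma tape_of_word_inj (aux : finType) : injective (tape_of_word aux).
Proof.
move=> w w' e; suff e' k : onth w k = onth w' k.
  by elim: w w' e' {e} => [|a w IH] [|a' w'] e' //;
    [have := e' 0%N|have := e' 0%N|
     have /= [->] := e' 0%N; congr cons; apply: IH => k; exact: (e' k.+1)].
have /= := congr1 (fun f => f (Posz k)) e.
by case: (onth w k) => [a|]; case: (onth w' k) => [a'|] //= [->].
Qed.

Lemma outputs_word_inj (M : otm) (A : set nat) (p w w' : bitseq) :
  outputs_word M A p w -> outputs_word M A p w' -> w = w'.
Proof.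
move=> [c hc e] [c' hc' e']; move: e'; rewrite -(halts_in_inj hc hc') => e'.
by apply: (@tape_of_word_inj (otm_aux M)); apply/funext => i; rewrite -e e'.
Qed.

Lemma tape_of_word_rcons (aux : finType) (w : bitseq) (b : bool) :
  (fun i : int => if i == (size w)%:Z then Some (inl b) else tape_of_word aux w i)
  = tape_of_word aux (rcons w b).
Proof.
apply/funext => -[k|k] //=.
rewrite eqz_nat -cats1 onth_cat; case: ltngtP => [lt|gt|->].
- by [].
- by rewrite !onth_default//= -?leqNgt ?subn_gt0 // ltnW.
- by rewrite subnn.
Qed.

Lemma tape_of_word_nil (aux : finType) (i : int) :
  tape_of_word aux [::] i = None.
Proof. by case: i => [[]|]. Qed.

(** * Printing a fixed word *)

Section Printer.
Variable w : bitseq.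

Let Q := option 'I_(size w).+1.

(** State [Some i] means that [i] bits of [w] have been written. [None] is a sink that never halts;
    it is entered on the first step when the input is nonempty. *)
Definition printer_delta (q : Q) (_ : option bool)
    (f : {ffun 'I_2 -> tape_symbol void}) :
    Q * move * {ffun 'I_2 -> tape_symbol void * move} :=
  match q with
  | Some i =>
    if (i == 0%N :> nat) && (f ord0 != None)
    then (None, Stay, [ffun j => (f j, Stay)])
    else (Some (inord i.+1), Stay,
          [ffun j => if j == ord_max then (Some (inl (nth false w i)), MoveRight)
                     else (f j, Stay)])
  | None => (None, Stay, [ffun j => (f j, Stay)])
  end.

(* The machine halts on the empty input only, which makes its domain
   prefix-free. *)
Definition printer : otm :=
  @Otm 0 void Q (Some ord0) [pred q | q == Some ord_max] printer_delta.

(** For an empty [w] the start state would itself be halting and every input would be accepted. *)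
Hypothesis w_gt0 : (0 < size w)%N.

Lemma printer_run (A : set nat) (t : nat) : (t <= size w)%N ->
  iter t (step A) (init_config printer [::]) =
  @Config printer (Some (inord t)) 0
    (fun j => if j == ord_max then t%:Z else 0)
    (fun j => tape_of_word _ (if j == ord_max then take t w else [::])).
Proof.
elim: t => [_|t IH lt].
  rewrite /init_config /=; congr Config.
  - by congr Some; apply/val_inj; rewrite /= inordK.
  - by apply/funext => j; case: ifP.
  - by apply/funext => j; rewrite take0; case: ifP; case: ifP.
rewrite iterS IH ?(ltnW lt)// /step /=.
rewrite ifN; last first.
  apply/eqP => -[] /(congr1 val) /=; rewrite inordK ?ltnS ?(ltnW lt)//.
  by move=> e; rewrite e ltnn in lt.
rewrite inordK ?ltnS ?(ltnW lt)// !ffunE /=. rewrite andbF.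
congr Config.
- apply/funext => j; rewrite ffunE; case: ifP => //= _.
  by rewrite -addn1 PoszD.
- apply/funext => j; rewrite !ffunE; case: ifP => //= _; last first.
    by apply/funext => i; rewrite tape_of_word_nil if_same.
  rewrite (take_nth false lt) -tape_of_word_rcons size_takel// ltnW//.
Qed.

Lemma printer_outputs (A : set nat) : outputs_word printer A [::] w.
Proof.
eexists; first by exists (size w); [exact: printer_run|
  apply/eqP; congr Some; apply/val_inj; rewrite /= inordK].
by rewrite /= take_size.
Qed.

Lemma printer_dom (A : set nat) (p : bitseq) : otm_dom printer A p -> p = [::].
Proof.
case: p => // a p [c [t <-]].
have stays (c' : config printer) :
    cfg_state c' = None -> cfg_state (step A c') = None.
  by move=> e; rewrite /step e.
have dead u : cfg_state (iter u.+1 (step A) (init_config printer (a :: p))) = None.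
  elim: u => [|u IHu]; last by rewrite iterS; exact: stays.
  rewrite /= /step /= ifN; last first.
    by apply/eqP => -[] e; move: w_gt0; rewrite -e.
  by rewrite !ffunE.
case: t => [|t]; last by rewrite dead.
by move=> /= /eqP[e]; move: w_gt0; rewrite -e.
Qed.

End Printer.

(** * Table lookup followed by a run of a given machine *)

(** Pairs of oracle bits are read in two steps: [MatchB], [SkipB] and [CopyB] remember the first bit
    while the second is read. The three rewinding phases bring back the input head, the head on the
    input tape of [V], and the oracle head. *)
Inductive phase (Q : Type) :=
  | Match | MatchB of bool | Skip | SkipB of bool | Copy | CopyB of bool
  | RewIn | RewTape | RewOracle | Dead | Run of Q.
Arguments Match {Q}.
Arguments MatchB {Q}.
Arguments Skip {Q}.
Arguments SkipB {Q}.
Arguments Copy {Q}.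
Arguments CopyB {Q}.
Arguments RewIn {Q}.
Arguments RewTape {Q}.
Arguments RewOracle {Q}.
Arguments Dead {Q}.

(** The embedding into a finite type serves only to transport the [finType] structure required of
    machine states. *)
Definition phase_code (Q : Type) (s : phase Q) : option bool * option bool * bool + Q :=
  match s with
  | Match => inl (None, Some true, true)
  | MatchB b => inl (None, None, b)
  | Skip => inl (None, Some true, false)
  | SkipB b => inl (Some true, None, b)
  | Copy => inl (None, Some false, true)
  | CopyB b => inl (Some false, None, b)
  | RewIn => inl (None, Some false, false)
  | RewTape => inl (Some true, Some true, true)
  | RewOracle => inl (Some true, Some true, false)
  | Dead => inl (Some true, Some false, true)
  | Run q => inr q
  end.

Definition phase_decode (Q : Type) (x : option bool * option bool * bool + Q) :
    option (phase Q) :=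
  Some (match x with
  | inl (None, None, b) => MatchB b
  | inl (Some true, None, b) => SkipB b
  | inl (Some false, None, b) => CopyB b
  | inl (None, Some true, true) => Match
  | inl (None, Some true, false) => Skip
  | inl (None, Some false, true) => Copy
  | inl (None, Some false, false) => RewIn
  | inl (Some true, Some true, true) => RewTape
  | inl (Some true, Some true, false) => RewOracle
  | inl _ => Dead
  | inr q => Run q
  end).

Lemma phase_codeK (Q : Type) : pcancel (@phase_code Q) (@phase_decode Q).
Proof. by case. Qed.

HB.instance Definition _ (Q : eqType) := Equality.copy (phase Q) (pcan_type (@phase_codeK Q)).
HB.instance Definition _ (Q : choiceType) := Choice.copy (phase Q) (pcan_type (@phase_codeK Q)).
HB.instance Definition _ (Q : countType) := Countable.copy (phase Q) (pcan_type (@phase_codeK Q)).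
HB.instance Definition _ (Q : finType) := Finite.copy (phase Q) (pcan_type (@phase_codeK Q)).

Section Lookup.
Variable V : otm.
Local Notation aux := (otm_aux V).
Local Notation Q := (otm_state V).

(* next phase, moves of the oracle head and of the input head, symbol written on
   the input tape of [V] and move of its head *)
Definition ctrl (s : phase Q) (cell : option bool) (c0 c1 : tape_symbol aux) :
    phase Q * move * move * tape_symbol aux * move :=
  let dead := (Dead, Stay, Stay, c1, Stay) in
  match s with
  | Match => if cell is Some f then (MatchB f, MoveRight, Stay, c1, Stay) else dead
  | MatchB true =>
    if (cell, c0) is (Some b, Some (inl b')) then
      if b == b' then (Match, MoveRight, MoveRight, c1, Stay)
      else (Skip, MoveRight, Stay, c1, Stay)
    else dead
  | MatchB false =>
    if (cell, c0) is (Some false, None) then (Copy, MoveRight, Stay, c1, Stay) else dead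
  | Skip => if cell is Some f then (SkipB f, MoveRight, Stay, c1, Stay) else dead
  | SkipB f =>
    if cell is Some b then
      (if ~~ f && b then RewIn else Skip, MoveRight, Stay, c1, Stay)
    else dead
  | RewIn =>
    if c0 is None then (Match, Stay, MoveRight, c1, Stay)
    else (RewIn, Stay, MoveLeft, c1, Stay)
  | Copy => if cell is Some f then (CopyB f, MoveRight, Stay, c1, Stay) else dead
  | CopyB true =>
    if cell is Some b then (Copy, MoveRight, Stay, Some (inl b), MoveRight) else dead
  | CopyB false => (RewTape, Stay, Stay, c1, MoveLeft)
  | RewTape =>
    if c1 is None then (RewOracle, Stay, Stay, c1, MoveRight)
    else (RewTape, Stay, Stay, c1, MoveLeft)
  | RewOracle =>
    if cell is None then (Run (otm_start V), MoveRight, Stay, c1, Stay)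
    else (RewOracle, MoveLeft, Stay, c1, Stay)
  | Dead | Run _ => dead
  end.

(* Tape [0] is the input tape, tape [j + 1] is tape [j] of [V], which is run
   with the empty oracle. *)
Definition lookup_delta (s : phase Q) (cell : option bool)
    (f : {ffun 'I_(otm_work V).+3 -> tape_symbol aux}) :
    phase Q * move * {ffun 'I_(otm_work V).+3 -> tape_symbol aux * move} :=
  if s is Run q then
    let: (q', mo, act) :=
      otm_delta q (omap (fun=> false) cell) [ffun j => f (lift ord0 j)] in
    (Run q', mo, [ffun j => if unlift ord0 j is Some j' then act j' else (f j, Stay)])
  else
    let: (s', mo, m0, x, m1) := ctrl s cell (f ord0) (f (lift ord0 ord0)) in
    (s', mo, [ffun j => if unlift ord0 j is Some j' then
                          if j' == ord0 then (x, m1) else (f j, Stay)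
                        else (f j, m0)]).

Definition lookup : otm :=
  @Otm (otm_work V).+1 aux (phase Q) Match
    (fun s => if s is Run q then otm_halt q else false) lookup_delta.

(** [h] is the position at which the search leaves the input head; it stays frozen while [V]
    runs. *)
Definition run_config (p : bitseq) (h : int) (c : config V) : config lookup :=
  @Config lookup (Run (cfg_state c)) (cfg_oracle_head c)
    (fun j => if unlift ord0 j is Some j' then cfg_head c j' else h)
    (fun j => if unlift ord0 j is Some j' then cfg_tape c j' else tape_of_word _ p).

(** Before [V] starts, only its input tape [t1] and the head [h1] on it can have changed; its other
    tapes are blank. *)
Definition search_config (p : bitseq) (s : phase Q) (o h h1 : int) (t1 : tape aux) :
    config lookup :=
  @Config lookup s o
    (fun j => if unlift ord0 j is Some j' then if j' == ord0 then h1 else 0 else h)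
    (fun j => if unlift ord0 j is Some j' then
                if j' == ord0 then t1 else tape_of_word _ [::]
              else tape_of_word _ p).

(** Reading every oracle bit as [false], while keeping the blanks on negative cells, amounts to
    consulting the empty oracle. *)
Lemma step_run (A : set nat) (p : bitseq) (h : int) (c : config V) :
  step A (run_config p h c) = run_config p h (step set0 c).
Proof.
rewrite /step /=; case: ifP => // _.
have -> : omap (fun=> false) (oracle_cell A (cfg_oracle_head c)) =
          oracle_cell set0 (cfg_oracle_head c).
  case: (cfg_oracle_head c) => //= k; congr Some.
  by apply/esym/negbTE/asboolPn.
have -> : [ffun j => [ffun j0 => (if unlift ord0 j0 is Some j' then cfg_tape c j'
              else tape_of_word aux p)
              (if unlift ord0 j0 is Some j' then cfg_head c j' else h)]
              (lift ord0 j)] = [ffun j => cfg_tape c j (cfg_head c j)]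
    :> {ffun 'I_(otm_work V).+2 -> tape_symbol aux}.
  by apply/ffunP => j; rewrite !ffunE liftK.
case: (otm_delta _ _ _) => -[q mo] act; rewrite /run_config /=; congr Config.
- by apply/funext => j; rewrite !ffunE; case: unliftP.
- apply/funext => j; apply/funext => i; rewrite !ffunE; case: unliftP => //=.
  by case: eqP => [->|].
Qed.

Lemma lookup_delta_search (s : phase Q) (cell : option bool)
    (f : {ffun 'I_(otm_work V).+3 -> tape_symbol aux}) :
  ~~ (if s is Run _ then true else false) ->
  lookup_delta s cell f =
  let: (s', mo, m0, x, m1) := ctrl s cell (f ord0) (f (lift ord0 ord0)) in
  (s', mo, [ffun j => if unlift ord0 j is Some j' then
                        if j' == ord0 then (x, m1) else (f j, Stay)
                      else (f j, m0)]).
Proof. by case: s. Qed.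

Lemma step_search (A : set nat) (p : bitseq) (s : phase Q) (o h h1 : int) (t1 : tape aux) :
  ~~ (if s is Run _ then true else false) ->
  step A (search_config p s o h h1 t1) =
  let: (s', mo, m0, x, m1) :=
    ctrl s (oracle_cell A o) (tape_of_word aux p h) (t1 h1) in
  search_config p s' (shift_head mo o) (shift_head m0 h) (shift_head m1 h1)
    (fun i => if i == h1 then x else t1 i).
Proof.
move=> sR.
rewrite /step /= ifN; last by case: s sR.
have -> : lookup_delta s (oracle_cell A o)
   [ffun j => (if unlift ord0 j is Some j' then
                 if j' == ord0 then t1 else tape_of_word _ [::]
               else tape_of_word _ p)
     (if unlift ord0 j is Some j' then if j' == ord0 then h1 else 0 else h)] =
  let: (s', mo, m0, x, m1) :=
    ctrl s (oracle_cell A o) (tape_of_word aux p h) (t1 h1) in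
  (s', mo, [ffun j => if unlift ord0 j is Some j' then
                        if j' == ord0 then (x, m1) else (None, Stay)
                      else (tape_of_word aux p h, m0)]).
  rewrite lookup_delta_search// !ffunE unlift_none liftK eqxx.
  case: (ctrl _ _ _ _) => -[[[s' mo] m0] x] m1; congr (_, _, _).
  apply/ffunP => j; rewrite !ffunE; case: unliftP => [j' _|_] //.
  by case: eqP => // _; rewrite tape_of_word_nil.
case: (ctrl _ _ _ _) => -[[[s' mo] m0] x] m1; rewrite /search_config; congr Config.
- by apply/funext => j; rewrite !ffunE; case: unliftP => // j' _; case: ifP.
- apply/funext => j; apply/funext => i; rewrite !ffunE.
  case: unliftP => [j' _|_]; last by case: eqP => [->|].
  by case: (j' == ord0) => //=; rewrite tape_of_word_nil if_same.
Qed.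

Lemma init_lookup (p : bitseq) :
  init_config lookup p = search_config p Match 0 0 0 (tape_of_word _ [::]).
Proof.
rewrite /init_config /search_config /=; congr Config.
  by apply/funext => j; case: unliftP => // j' _; case: ifP.
apply/funext => j; case: unliftP => [j' ->|->] //=.
by rewrite if_same.
Qed.

Lemma run_start (p w : bitseq) (h : int) :
  search_config p (Run (otm_start V)) 0 h 0 (tape_of_word _ w) =
  run_config p h (init_config V w).
Proof.
rewrite /run_config /search_config /=; congr Config.
  by apply/funext => j; case: unliftP => // j' _; case: ifP.
by apply/funext => j; case: unliftP => // j' _; case: ifP.
Qed.

End Lookup.

Lemma tape_of_word_in (aux : finType) (p : bitseq) (h : int) :
  0 <= h < (size p)%:Z -> exists b, tape_of_word aux p h = Some (inl b).
Proof.
case: h => [k|k]; last by lia.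
move=> hk /=; have : onth p k by rewrite onthTE; lia.
by case: (onth p k) => // b _; exists b.
Qed.

Lemma tape_of_word_out (aux : finType) (p : bitseq) (h : int) :
  (h < 0) || ((size p)%:Z <= h) -> tape_of_word aux p h = None.
Proof.
case: h => [k|k] // hk /=.
by rewrite onth_default//; lia.
Qed.

Lemma tape_of_word_prefix (aux : finType) (p p' : bitseq) (h : int) :
  prefix p p' -> h < (size p)%:Z -> tape_of_word aux p' h = tape_of_word aux p h.
Proof.
move=> /prefixP[s ->]; case: h => [k|k] // hk /=.
by rewrite onth_cat ifT//; lia.
Qed.

Lemma write_same (aux : finType) (t : tape aux) (h : int) :
  (fun i => if i == h then t h else t i) = t.
Proof. by apply/funext => i; case: eqP => [->|]. Qed.

(** * Domain and outputs of the lookup machine *)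

Section Lookup.
Variable V : otm.
Local Notation aux := (otm_aux V).
Local Notation blank := (tape_of_word aux [::]).

Lemma step_dead (A : set nat) (c : config (lookup V)) :
  cfg_state c = Dead -> cfg_state (step A c) = Dead.
Proof. by move=> e; rewrite /step e. Qed.

(** Cell [size p] is reached only while matching, where its blank signals that all of [p] has been
    compared. Rewinding goes one cell to the left of the input. Copying and later phases are
    excluded, since the runs on two comparable words have separated before. *)
Definition scan_range (p : bitseq) (s : phase (otm_state V)) (h : int) : bool :=
  match s with
  | Match | MatchB _ => 0 <= h <= (size p)%:Z
  | Skip | SkipB _ => 0 <= h < (size p)%:Z
  | RewIn => -1 <= h < (size p)%:Z
  | _ => false
  end.

Lemma scan_not_run p s h : scan_range p s h ->
  ~~ (if s is Run _ then true else false).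
Proof. by case: s. Qed.

(* Until one of the two runs is dead, runs on a word and on a proper extension
   of it read the same symbols. *)
Definition lockstep (p p' : bitseq) (c c' : config (lookup V)) : Prop :=
  [\/ cfg_state c = Dead, cfg_state c' = Dead |
      exists s o h, [/\ c = search_config p s o h 0 blank,
        c' = search_config p' s o h 0 blank & scan_range p s h]].

(** The inputs first differ at cell [size p], which is read only by [MatchB]. If a bit is expected
    there, the run on [p] finds a blank and dies; if the end of the word is expected, the run on
    [p'] finds a bit and dies. *)
Lemma lockstep_step (A : set nat) (p p' : bitseq) (c c' : config (lookup V)) :
  prefix p p' -> p != p' -> lockstep p p' c c' ->
  lockstep p p' (step A c) (step A c').
Proof.
move=> pp' npp' [/(step_dead A)|/(step_dead A)|[s [pos [h [-> -> hs]]]]];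
  [by constructor 1|by constructor 2|].
have szp : (size p < size p')%N.
  case/prefixP: pp' npp' => -[|a u] ->; first by rewrite cats0 eqxx.
  by rewrite size_cat /=; lia.
have same s' mo m0 : scan_range p s' (shift_head m0 h) ->
  lockstep p p'
   (search_config p s' (shift_head mo pos) (shift_head m0 h) (shift_head Stay 0)
      (fun i => if i == 0 then blank 0 else blank i))
   (search_config p' s' (shift_head mo pos) (shift_head m0 h) (shift_head Stay 0)
      (fun i => if i == 0 then blank 0 else blank i)).
  move=> hs'; rewrite write_same; constructor 3.
  by exists s', (shift_head mo pos), (shift_head m0 h).
rewrite !step_search ?(scan_not_run hs)//.
case: s hs => [|[]| |f| |b| | | | |q] //=.
- by case: (oracle_cell A pos) => [f|] hs; [exact: same|constructor 1].
- case: (oracle_cell A pos) => [b|] hs; last by constructor 1.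
  have [hlt|hge] := ltP h (size p)%:Z; last first.
    by rewrite (tape_of_word_out _ (p := p)) ?hge ?orbT//; constructor 1.
  rewrite (tape_of_word_prefix _ pp' hlt).
  have [|b' ->] := @tape_of_word_in aux p h; first by lia.
  by case: eqP => _; apply: same => /=; lia.
- case: (oracle_cell A pos) => [[]|] hs; [by constructor 1| |by constructor 1].
  have [hlt|hge] := ltP h (size p)%:Z.
    by have [|b' ->] := @tape_of_word_in aux p h; [lia|constructor 1].
  by have [|b' ->] := @tape_of_word_in aux p' h; [lia|constructor 2].
- by case: (oracle_cell A pos) => [f|] hs; [exact: same|constructor 1].
- case: (oracle_cell A pos) => [b|] hs; last by constructor 1.
  by case: ifP => _; apply: same => /=; lia.
- move=> hs; rewrite (tape_of_word_prefix _ pp'); last by lia.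
  have [hlt|hge] := ltP h 0.
    by rewrite tape_of_word_out ?hlt//; apply: same => /=; lia.
  have [|b' ->] := @tape_of_word_in aux p h; first by lia.
  by apply: same => /=; lia.
Qed.

(** After [t + t'] steps both runs have halted, whereas in each case of [lockstep] at least one run
    is in a state that is not halting. *)
Lemma lookup_prefix_free : oracle_prefix_free (lookup V).
Proof.
move=> A p p' [c [t tc hc]] [c' [t' tc' hc']] pp'.
apply/eqP; apply: contraT => npp'.
have lock u : lockstep p p' (iter u (step A) (init_config (lookup V) p))
                            (iter u (step A) (init_config (lookup V) p')).
  elim: u => [|u IH]; last by rewrite !iterS; exact: lockstep_step.
  by constructor 3; exists Match, 0, 0; rewrite !init_lookup.
have := lock (t + t')%N; rewrite [in X in lockstep _ _ X]addnC !iterD tc tc' !halt_iter//.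
case=> [e|e|[s [pos [h [e _ hs]]]]].
- by move: hc; rewrite e.
- by move: hc'; rewrite e.
- by move: hc; rewrite e; case: s hs {e}.
Qed.

(** An invariant for every oracle, including those that encode no table. Only [SoundRun] can halt,
    so every output is one of [V] with the empty oracle. The bounds on the head positions make both
    rewinding phases end exactly on cell 0. *)
Inductive sound_config (p : bitseq) : config (lookup V) -> Prop :=
| SoundDead (c : config (lookup V)) : cfg_state c = Dead -> sound_config p c
| SoundScan s o h : 0 <= o ->
    match s with
    | Match | MatchB _ | Skip | SkipB _ | RewIn => true | _ => false end ->
    sound_config p (search_config p s o h 0 blank)
| SoundCopy s o h w : 0 <= o ->
    match s with Copy | CopyB _ => true | _ => false end ->
    sound_config p (search_config p s o h (size w)%:Z (tape_of_word aux w))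
| SoundRewTape o h h1 w : 0 <= o -> -1 <= h1 < (size w)%:Z ->
    sound_config p (search_config p RewTape o h h1 (tape_of_word aux w))
| SoundRewOracle o h w : -1 <= o ->
    sound_config p (search_config p RewOracle o h 0 (tape_of_word aux w))
| SoundRun w t h :
    sound_config p (run_config p h (iter t (step set0) (init_config V w))).

Lemma oracle_cell_pos (A : set nat) (o : int) : 0 <= o ->
  exists b, oracle_cell A o = Some b.
Proof. by case: o => // k _; exists `[< A k >]. Qed.

Lemma sound_step (A : set nat) (p : bitseq) (c : config (lookup V)) :
  sound_config p c -> sound_config p (step A c).
Proof.
case=> {c}.
- by move=> c /(step_dead A); by apply: SoundDead.
- move=> s o h o0 hs.
  have scan s' mo m0 : 0 <= shift_head mo o ->
    match s' with
    | Match | MatchB _ | Skip | SkipB _ | RewIn => true | _ => false end ->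
    sound_config p (search_config p s' (shift_head mo o) (shift_head m0 h)
      (shift_head Stay 0) (fun i => if i == 0 then blank 0 else blank i)).
    by move=> ? ?; rewrite write_same; apply: SoundScan.
  have [b eb] := oracle_cell_pos A o0.
  have o1 : 0 <= o + 1 by lia.
  rewrite step_search; last by case: s hs.
  case: s hs => [|[]| |f| |b'| | | | |q] //= _; rewrite ?eb.
  + exact: scan.
  + case: (tape_of_word _ p h) => [[b'|a]|]; try by apply: SoundDead.
    by case: ifP => _; exact: scan.
  + case: b eb => eb /=; first by apply: SoundDead.
    case: (tape_of_word _ p h) => [?|]; first by apply: SoundDead.
    rewrite write_same; exact: (@SoundCopy _ Copy _ _ [::]).
  + exact: scan.
  + by apply: scan => //; case: ifP.
  + by case: (tape_of_word _ p h) => [?|]; exact: scan.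
- move=> s o h w o0 hs.
  have [b eb] := oracle_cell_pos A o0.
  have o1 : 0 <= o + 1 by lia.
  rewrite step_search; last by case: s hs.
  case: s hs => [|[]| |f| |[]| | | | |q] //= _; rewrite ?eb.
  + by rewrite write_same; apply: SoundCopy.
  + rewrite tape_of_word_rcons.
    have -> : shift_head MoveRight (size w)%:Z = (size (rcons w b))%:Z.
      by rewrite size_rcons /=; lia.
    exact: SoundCopy.
  + by rewrite write_same; apply: SoundRewTape => //; lia.
- move=> o h h1 w o0 hh1.
  rewrite step_search//=.
  case e : (tape_of_word aux w h1) => [x|]; rewrite -e write_same.
    apply: SoundRewTape => //=.
    have [|] := ltP h1 0; last by lia.
    by move=> h10; rewrite tape_of_word_out ?h10 in e.
  (* A blank at [h1 < size w] can only be the cell -1, just before the word. *)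
  suff -> : shift_head MoveRight h1 = 0 by apply: SoundRewOracle => /=; lia.
  rewrite /=; have [|] := ltP h1 0; first by lia.
  move=> h10; have [|b] := @tape_of_word_in aux w h1; first by lia.
  by rewrite e.
- move=> o h w o0.
  rewrite step_search//=.
  case e : (oracle_cell A o) => [b|]; rewrite write_same.
    apply: SoundRewOracle => /=; case: o o0 e => //= *; lia.
  have -> : shift_head MoveRight o = 0 by rewrite /=; case: o o0 e => //= *; lia.
  by rewrite run_start; exact: (@SoundRun _ _ 0).
- by move=> w t h; rewrite step_run -iterS; exact: SoundRun.
Qed.

Lemma run_outputs (A : set nat) (p w u : bitseq) (h : int) :
  reach A (init_config (lookup V) p) (run_config p h (init_config V w)) ->
  outputs_word V set0 w u -> outputs_word (lookup V) A p u.
Proof.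
move=> [t0 et0] [c [t et hc] eu].
exists (run_config p h c) => //=.
  exists (t + t0)%N => //; rewrite iterD et0 -et.
  by elim: t {et} => //= t ->; rewrite step_run.
(* The output tape is that of [V], whose tapes are shifted by one. *)
have -> : ord_max = lift ord0 ord_max :> 'I_(otm_work V).+3 by exact: val_inj.
by rewrite liftK.
Qed.

Lemma lookup_ball_machine (n : nat) : ball_machine n V -> ball_machine n (lookup V).
Proof.
move=> [_ Vb]; split; first exact: lookup_prefix_free.
move=> A p [c [t tc hc]].
have : sound_config p c.
  rewrite -tc; elim: t {tc} => [|t IH]; last by rewrite iterS; exact: sound_step.
  by rewrite init_lookup; exact: SoundScan.
move=> sc; case: sc tc hc => {c}.
- by move=> c e _; rewrite e.
- by case.
- by case.
- by [].
- by [].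
move=> w t' h tc hc.
have [|b [c [t2 et2 hc2] bc]] := Vb set0 w.
  by exists (iter t' (step set0) (init_config V w)); exists t'.
exists b; exists (run_config p h (iter t' (step set0) (init_config V w))).
  by exists t.
(* By determinism, the halting configuration that carries the code of [b] is the one reached
   here. *)
have := @halts_in_inj V set0 w c _ (ex_intro2 _ _ t2 et2 hc2) (ex_intro2 _ _ t' erefl hc).
move=> <- /=.
have -> : ord_max = lift ord0 ord_max :> 'I_(otm_work V).+3 by exact: val_inj.
by rewrite liftK.
Qed.

End Lookup.

(* An oracle is read as a stream of pairs of bits: [(true, b)] is the bit [b],
   [(false, false)] separates the two words of an entry and [(false, true)] ends
   the entry. *)
Definition entry (s t : bitseq) : seq (bool * bool) :=
  map (pair true) s ++ (false, false) :: rcons (map (pair true) t) (false, true).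

Fixpoint reads (A : set nat) (o : nat) (l : seq (bool * bool)) : Prop :=
  if l is x :: l' then
    [/\ oracle_cell A o%:Z = Some x.1, oracle_cell A o.+1%:Z = Some x.2 &
        reads A o.+2 l']
  else True.

Lemma reads_cat (A : set nat) (o : nat) (l1 l2 : seq (bool * bool)) :
  reads A o (l1 ++ l2) -> reads A o l1 /\ reads A (o + (size l1).*2) l2.
Proof.
elim: l1 o => [|x l1 IH] o /=; first by rewrite double0 addn0.
by move=> [? ? /IH[? ?]]; rewrite doubleS !addnS -!addSn.
Qed.

Lemma reads_nth (A : set nat) (o : nat) (l : seq (bool * bool)) :
  (forall j, (j < size l)%N ->
     oracle_cell A (o + j.*2)%:Z = Some (nth (false, false) l j).1 /\
     oracle_cell A (o + j.*2.+1)%:Z = Some (nth (false, false) l j).2) ->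
  reads A o l.
Proof.
elim: l o => [|x l IH] o //= H; split.
- by have [+ _] := H 0%N isT; rewrite addn0.
- by have [_ +] := H 0%N isT; rewrite addn1.
- by apply: IH => j hj; have := H j.+1 hj; rewrite doubleS !addnS -!addSn.
Qed.

Lemma incomparable_split (p q : bitseq) : ~~ prefix p q -> ~~ prefix q p ->
  exists u b s r, p = u ++ b :: s /\ q = u ++ ~~ b :: r.
Proof.
elim: p q => [|a p IH] [|c q] //; rewrite ?prefix0s// !prefix_cons.
have [<-|ac] := eqVneq a c.
  move=> /IH{}IH /IH[u [b [s [r [-> ->]]]]].
  by exists (a :: u), b, s, r.
move=> _ _; exists [::], a, p, q; split=> //=; congr cons.
by case: a c ac => [] [].
Qed.

(** * Runs of the lookup machine along encoded entries *)

Section Lookup.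
Variables (V : otm) (A : set nat) (p : bitseq).
Local Notation aux := (otm_aux V).
Local Notation blank := (tape_of_word aux [::]).
Local Notation scan s o h := (@search_config V p s o h 0 blank).

Lemma posz_succ (k : nat) : k%:Z + 1 = k.+1%:Z.
Proof. by rewrite -addn1 PoszD. Qed.

(** The already matched part [s1] is kept general for the induction on the remaining part [s2]. *)
Lemma match_bits (s2 s1 rest : bitseq) (o : nat) :
  p = s1 ++ s2 ++ rest -> reads A o (map (pair true) s2) ->
  reach A (scan Match o%:Z (size s1)%:Z)
          (scan Match (o + (size s2).*2)%:Z (size (s1 ++ s2))%:Z).
Proof.
elim: s2 s1 o => [|b s2 IH] s1 o ep.
  by rewrite addn0 cats0 => _; exact: reach_refl.
move=> [e1 e2 hs2].
apply/reach_step; rewrite step_search// e1 /= write_same ?posz_succ.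
apply/reach_step; rewrite step_search// e2.
have -> : tape_of_word aux p (size s1)%:Z = Some (inl b).
  by rewrite ep /= onth_cat ltnn subnn.
rewrite /= eqxx /= write_same !posz_succ.
have := IH (rcons s1 b) o.+2; rewrite ep -!cats1 -!catA /= size_cat addn1.
by rewrite doubleS !addnS !addSn; apply.
Qed.

(** As [l] contains no end marker, skipping stops at the marker appended to it and not before. *)
Lemma skip_symbols (l : seq (bool * bool)) (o : nat) (h : int) :
  (false, true) \notin l -> reads A o (rcons l (false, true)) ->
  reach A (scan Skip o%:Z h) (scan RewIn (o + (size l).+1.*2)%:Z h).
Proof.
elim: l o => [|[f b] l IH] o.
  move=> _ [e1 e2 _].
  apply/reach_step; rewrite step_search// e1 /= write_same ?posz_succ.
  apply/reach_step; rewrite step_search// e2 /= write_same.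
  rewrite ?posz_succ addn2.
  exact: reach_refl.
rewrite inE negb_or => /andP[fb hl] [e1 e2 {}/IH IH].
apply/reach_step; rewrite step_search// e1 /= write_same ?posz_succ.
apply/reach_step; rewrite step_search// e2 /= write_same.
rewrite ?posz_succ.
rewrite ifN; last by case: f b fb {e1 e2} => [] [].
by move: (IH hl); rewrite /= !doubleS !addnS !addSn.
Qed.

(** The head must start on a letter: on the blank after the input, [RewIn] would take that blank for
    the left end. *)
Lemma rewind_input (o : int) (h : nat) : (h < size p)%N ->
  reach A (scan RewIn o h%:Z) (scan Match o 0).
Proof.
elim: h => [|h IH] hp; apply/reach_step; rewrite step_search//.
  have [|b ->] := @tape_of_word_in aux p 0; first by lia.
  rewrite /= write_same; apply/reach_step; rewrite step_search//.
  by rewrite tape_of_word_out//= write_same; exact: reach_refl.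
have [|b ->] := @tape_of_word_in aux p h.+1%:Z; first by lia.
rewrite /= write_same.
have -> : h.+1%:Z - 1 = h%:Z by lia.
by apply: IH; lia.
Qed.

Lemma notin_bits (u : bitseq) : (false, true) \notin map (pair true) u.
Proof. by elim: u. Qed.

(** Incomparable words have a first differing bit. There the comparison is abandoned, the remainder
    of the entry is skipped and the input head is rewound. *)
Lemma skip_entry (s t : bitseq) (o : nat) :
  ~~ prefix s p -> ~~ prefix p s -> reads A o (entry s t) ->
  reach A (scan Match o%:Z 0) (scan Match (o + (size (entry s t)).*2)%:Z 0).
Proof.
move=> sp ps; have [u [b [s' [r [es ep]]]]] := incomparable_split sp ps.
rewrite /entry es map_cat -catA => /reads_cat[hu].
have -> : map (pair true) (b :: s') ++ (false, false) :: rcons (map (pair true) t) (false, true) =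
  (true, b) :: rcons (map (pair true) s' ++ (false, false) :: map (pair true) t) (false, true).
  by rewrite /= -rcons_cons rcons_cat.
move=> [e1 e2 ht].
have := @match_bits u [::] (~~ b :: r) o ep hu.
rewrite /= => /reach_trans; apply.
move: e1 e2 ht; rewrite size_map; set o' := (o + _)%N => e1 e2 ht.
apply/reach_step; rewrite step_search// e1 /= write_same ?posz_succ.
apply/reach_step; rewrite step_search// e2.
have -> : tape_of_word aux p (size u)%:Z = Some (inl (~~ b)).
  by rewrite ep /= onth_cat ltnn subnn.
rewrite /= ifN; last by case: (b).
rewrite /= write_same !posz_succ.
apply: reach_trans (skip_symbols _ _ ht) _.
  by rewrite mem_cat inE !negb_or !notin_bits.
set l := map _ s' ++ _ :: map _ t.
have := @rewind_input (o'.+2 + (size l).+1.*2)%:Z (size u).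
have up : (size u < size p)%N by rewrite ep size_cat /= addnS ltnS leq_addr.
move=> /(_ up).
congr reach; congr search_config; congr Posz.
rewrite /o' [X in _ = (o + X.*2)%N]size_cat /= size_rcons size_map; lia.
Qed.

Lemma copy_bits (t2 t1 : bitseq) (o : nat) (h : int) :
  reads A o (map (pair true) t2) ->
  reach A (search_config p Copy o%:Z h (size t1)%:Z (tape_of_word aux t1))
    (search_config p Copy (o + (size t2).*2)%:Z h (size (t1 ++ t2))%:Z
      (tape_of_word aux (t1 ++ t2))).
Proof.
elim: t2 t1 o => [|b t2 IH] t1 o.
  by rewrite addn0 cats0 => _; exact: reach_refl.
move=> [e1 e2 ht2].
apply/reach_step; rewrite step_search// e1 /= write_same ?posz_succ.
apply/reach_step; rewrite step_search// e2 /= tape_of_word_rcons.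
rewrite ?posz_succ.
have := IH (rcons t1 b) o.+2 ht2; rewrite cat_rcons size_rcons.
by rewrite doubleS !addnS !addSn.
Qed.

(** Writing the position as [k - 1] lets the induction begin on the blank cell -1. *)
Lemma rewind_tape (o h : int) (w : bitseq) (k : nat) : (k <= size w)%N ->
  reach A (search_config p RewTape o h (k%:Z - 1) (tape_of_word aux w))
          (search_config p RewOracle o h 0 (tape_of_word aux w)).
Proof.
elim: k => [|k IH] kw; apply/reach_step; rewrite step_search//.
  by rewrite [tape_of_word _ w _]tape_of_word_out//= write_same; exact: reach_refl.
have -> : k.+1%:Z - 1 = k%:Z by lia.
case e : (tape_of_word aux w k%:Z) => [b|].
  by rewrite /= -e write_same; apply: IH; exact: ltnW.
by have [|b] := @tape_of_word_in aux w k%:Z; [lia|rewrite e].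
Qed.

Lemma rewind_oracle (o : nat) (h : int) (w : bitseq) :
  reach A (search_config p RewOracle o%:Z h 0 (tape_of_word aux w))
          (run_config p h (init_config V w)).
Proof.
elim: o => [|o IH]; apply/reach_step; rewrite step_search//= write_same.
  apply/reach_step; rewrite step_search//= write_same.
  by rewrite run_start; exact: reach_refl.
by have -> : o.+1%:Z - 1 = o%:Z by lia.
Qed.

(** When the key equals the input, the separator is met exactly at the blank after the input. The
    second word is then copied, and both the tape head and the oracle head are rewound. *)
Lemma run_entry (t : bitseq) (o : nat) : reads A o (entry p t) ->
  reach A (scan Match o%:Z 0) (run_config p (size p)%:Z (init_config V t)).
Proof.
rewrite /entry => /reads_cat[hp].
rewrite size_map => -[e1 e2]; rewrite -cats1 => /reads_cat[ht].
rewrite size_map => -[e3 e4 _].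
have := @match_bits p [::] [::] o; rewrite cats0 => /(_ erefl hp) /reach_trans; apply.
set o' := (o + _)%N in e1 e2 e3 e4 ht *.
apply/reach_step; rewrite step_search// e1 /= write_same ?posz_succ.
apply/reach_step; rewrite step_search//.
rewrite [tape_of_word _ p _]tape_of_word_out ?lexx ?orbT// e2 /= write_same posz_succ.
apply: reach_trans (@copy_bits t [::] _ _ ht) _.
set o2 := (o'.+2 + _)%N in e3 e4 *.
apply/reach_step; rewrite step_search// e3 /= write_same ?posz_succ.
apply/reach_step; rewrite step_search//= write_same.
apply: reach_trans (rewind_tape _ _ (leqnn _)) _.
exact: rewind_oracle.
Qed.

End Lookup.

(** * The oracle listing a table of entries *)

Section Table.
Variable e : nat -> seq (bool * bool).
Hypothesis e_gt0 : forall k, (0 < size (e k))%N.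

Let stream k := flatten [seq e i | i <- iota 0 k].

(* The [m]-th cell is already determined by the first [m + 1] entries. *)
Definition table_oracle : set nat :=
  [set m | let x := nth (false, false) (stream m.+1) m./2 in
           if odd m then x.2 else x.1].

Lemma stream_rec k : stream k.+1 = stream k ++ e k.
Proof. by rewrite /stream -addn1 iotaD map_cat flatten_cat /= cats0. Qed.

Lemma stream_size k : (k <= size (stream k))%N.
Proof.
elim: k => // k IH; rewrite stream_rec size_cat.
by rewrite -addn1 leq_add.
Qed.

Lemma stream_nth j k i : (i < size (stream j))%N -> (i < size (stream k))%N ->
  nth (false, false) (stream j) i = nth (false, false) (stream k) i.
Proof.
have mono a b : (i < size (stream a))%N ->
    nth (false, false) (stream (b + a)) i = nth (false, false) (stream a) i.
  move=> ia; elim: b => // b; rewrite addSn stream_rec nth_cat.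
  rewrite ifT// (leq_trans ia)// {ia}; elim: b => // b /leq_trans; apply.
  by rewrite addSn stream_rec size_cat leq_addr.
by move=> ij ik; rewrite -(mono _ k ij) addnC mono.
Qed.

Lemma table_oracle_reads k : reads table_oracle (size (stream k)).*2 (e k).
Proof.
(* [table_oracle] reads each cell from a different initial segment of the stream; here they are all
   replaced by one common segment. *)
have cell m : (m./2 < size (stream k.+1))%N ->
  oracle_cell table_oracle m%:Z = let x := nth (false, false) (stream k.+1) m./2 in
  Some (if odd m then x.2 else x.1).
  move=> hm; rewrite /= /table_oracle /= (@stream_nth m.+1 k.+1)//.
    by congr Some; rewrite asboolb.
  apply: leq_trans (stream_size _); rewrite ltnS.
  by rewrite -{2}(odd_double_half m) -addnn; lia.
apply: reads_nth => j hj.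
have jh : (size (stream k) + j < size (stream k.+1))%N.
  by rewrite stream_rec size_cat ltn_add2l.
have nj : nth (false, false) (stream k.+1) (size (stream k) + j) = nth (false, false) (e k) j.
  by rewrite stream_rec nth_cat ltnNge leq_addr /= addKn.
split.
  by rewrite cell -doubleD doubleK// odd_double nj.
have half : (((size (stream k) + j).*2.+1)./2 = size (stream k) + j)%N.
  exact: (half_bit_double _ true).
by rewrite addnS -doubleD cell half// oddS odd_double nj.
Qed.

Lemma table_search (V : otm) (s t : nat -> bitseq) (k : nat) :
  (forall i, e i = entry (s i) (t i)) ->
  (forall i, (i < k)%N -> ~~ prefix (s i) (s k) /\ ~~ prefix (s k) (s i)) ->
  reach table_oracle (init_config (lookup V) (s k))
    (run_config (s k) (size (s k))%:Z (init_config V (t k))).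
Proof.
move=> est inc; rewrite init_lookup.
have skip j : (j <= k)%N -> reach table_oracle
    (search_config (s k) Match 0 0 0 (tape_of_word (otm_aux V) [::]))
    (search_config (s k) Match (size (stream j)).*2%:Z 0 0 (tape_of_word (otm_aux V) [::])).
  elim: j => [_|j IH jk]; first exact: reach_refl.
  apply: reach_trans (IH (ltnW jk)) _; have [h1 h2] := inc _ jk.
  have := table_oracle_reads j; rewrite est => /(@skip_entry V _ _ _ _ _ h1 h2).
  by rewrite stream_rec size_cat doubleD est.
apply: reach_trans (skip k (leqnn k)) _; apply: run_entry.
by rewrite -est; exact: table_oracle_reads.
Qed.

End Table.

(** The hypothesis makes distinct keys incomparable, so on input [s i] every earlier entry is
    skipped and the search stops at entry [i], for all [i] with the same oracle. *)
Lemma lookup_table (V : otm) (s t : nat -> bitseq) :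
  (forall i j, prefix (s i) (s j) -> i = j) ->
  exists A : set nat, forall i u,
    outputs_word V set0 (t i) u -> outputs_word (lookup V) A (s i) u.
Proof.
move=> sfree; exists (table_oracle (fun i => entry (s i) (t i))) => i u.
apply: run_outputs; apply: (table_search (e := fun i => entry (s i) (t i))) => //.
  by move=> k; rewrite /entry size_cat /= addnS.
by move=> j ji; split; apply/negP => /sfree eij; move: ji; rewrite eij ltnn.
Qed.

(** * Prefix codes *)

Section Pow2.
Variable R : realType.

Lemma pow2N_gt0 (k : nat) : 0 < (2%:R : R) ^- k.
Proof. by rewrite invr_gt0 exprn_gt0// ltr0n. Qed.

Lemma pow2_powR (m : nat) (s : R) : (2%:R ^- m) `^ s = 2%:R `^ (- (m%:R * s)).
Proof. by rewrite -powR_invn// -powRrM mulNr. Qed.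

Lemma pow2_small (e : R) : 0 < e -> exists L, 2%:R ^- L < e.
Proof.
move=> e0; have [N _ HN] := near_infty_natSinv_expn_lt (PosNum e0).
by exists N; have := HN N (leqnn N); rewrite /= -[1 / _]mul1r div1r mul1r.
Qed.

Lemma pow2_powR_small (c e : R) (k : nat) : 0 < c -> 0 < e ->
  exists2 N, (k <= N)%N & 2%:R `^ (- (N%:R * c)) <= e.
Proof.
move=> c0 /pow2_small[L Le]; exists (maxn k (Num.truncn (L%:R / c)).+1).
  exact: leq_maxl.
apply: le_trans (ltW Le); rewrite -powR_invn// ler_powR ?ler1n// lerN2.
rewrite -ler_pdivrMr//; apply: ltW; apply: lt_le_trans (Num.Theory.truncnS_gt _) _.
by rewrite ler_nat leq_maxr.
Qed.

Lemma pow2_le_powR (y : R) : 0 <= y ->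
  2%:R ^- (Num.truncn y).+1 <= 2%:R `^ (- y) :> R.
Proof.
move=> y0; rewrite -powR_invn// ler_powR ?ler1n// lerN2.
by apply: ltW; exact: Num.Theory.truncnS_gt.
Qed.

(** Split [2^(-ms)] as [2^(-m(s-s0))] times [2^(-m s0)] and use [m >= N] in the first factor,
    [s0 m >= l] in the second. *)
Lemma scale_estimate (s0 s : R) (N m l : nat) : s0 < s -> (N <= m)%N ->
  l%:R <= s0 * m%:R ->
  (2%:R ^- m) `^ s <= 2%:R `^ (- (N%:R * (s - s0))) * 2%:R ^- l.
Proof.
move=> s0s Nm lm; rewrite pow2_powR -[_ ^- l]powR_invn// -powRD; last first.
  by rewrite pnatr_eq0 implybT.
rewrite ler_powR ?ler1n// -opprD lerN2.
have : (N%:R : R) * (s - s0) <= m%:R * (s - s0).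
  by rewrite ler_wpM2r ?ler_nat// subr_ge0 ltW.
lra.
Qed.

End Pow2.

(** Induction on a bound for the lengths: removing the first bit turns the words starting with [b]
    into a prefix-free set of shorter words and doubles their weights. *)
Lemma kraft (R : realFieldType) (s : seq bitseq) : uniq s ->
  {in s &, forall p q, prefix p q -> p = q} ->
  \sum_(p <- s) (2%:R : R) ^- size p <= 1.
Proof.
have [m] : exists m, {in s, forall p, size p < m}%N.
  exists (\max_(p <- s) size p).+1 => p ps.
  by rewrite ltnS; exact: leq_bigmax_seq.
elim: m s => [|m IH] s sm us fs.
  case: s sm {us fs} => [|p s] sm; first by rewrite big_nil.
  by have := sm p (mem_head _ _).
(* The empty word is a prefix of all others, so it can only occur alone. *)
have [nils|nnils] := boolP ([::] \in s).
  have s1 p : p \in s -> p = [::].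
    by move=> ps; rewrite -(fs _ _ nils ps)// prefix0s.
  case: s us {sm fs nils} s1 => [|p [|q s]] /=; first by rewrite big_nil ler01.
    by move=> _ /(_ p (mem_head _ _)) ->; rewrite big_seq1 expr0 invr1.
  move=> + s1; rewrite (s1 p) ?mem_head// (s1 q) ?inE ?eqxx ?orbT//.
have part b : \sum_(p <- s | head false p == b) (2%:R : R) ^- size p <= 2^-1.
  pose t := [seq behead p | p <- s & head false p == b].
  have tE p : p \in t -> (b :: p) \in s.
    case/mapP => -[|c q]; rewrite mem_filter => /andP[/= /eqP e qs ->].
      by rewrite qs in nnils.
    by rewrite -e.
  have : \sum_(p <- t) (2%:R : R) ^- size p <= 1.
    apply: IH => [p /tE/sm//| |p q /tE ps /tE qs pq].
      rewrite map_inj_in_uniq ?filter_uniq// => -[|c p] [|c' q];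
        rewrite !mem_filter /= => /andP[/eqP e ps] /andP[/eqP e' qs] //=;
        rewrite ?ps ?qs// in nnils *.
      by move=> ->; rewrite e e'.
    have h : prefix (b :: p) (b :: q) by rewrite prefix_cons eqxx.
    by have [] := fs _ _ ps qs h.
  rewrite big_map big_filter => h.
  rewrite -(ler_pM2l (x := 2%:R)) ?ltr0n// divff ?pnatr_eq0//.
  apply: le_trans h; rewrite mulr_sumr.
  rewrite [leLHS]big_seq_cond [leRHS]big_seq_cond; apply: ler_sum => -[|c p] /andP[ps _].
    by rewrite ps in nnils.
  by rewrite /= exprS invfM mulrA divff ?pnatr_eq0// mul1r.
rewrite (bigID (fun p => head false p == true)) /=.
rewrite [X in _ + X](eq_bigl (fun p => head false p == false)); last first.
  by move=> p; case: (head _ p).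
have := part true; have := part false; lra.
Qed.

(** The binary value, most significant bit first. The word [w] stands for the dyadic interval of
    length [2^-|w|] with left end [word_value w / 2^|w|]. *)
Fixpoint word_value (w : bitseq) : nat :=
  if w is b :: w' then (b * 2 ^ size w' + word_value w')%N else 0%N.

Lemma word_value_lt (w : bitseq) : (word_value w < 2 ^ size w)%N.
Proof. by elim: w => //= b w IH; rewrite expnS; case: b; lia. Qed.

Lemma word_value_cat (u w : bitseq) :
  word_value (u ++ w) = (word_value u * 2 ^ size w + word_value w)%N.
Proof.
elim: u => //= b u ->; rewrite size_cat expnD; case: b; lia.
Qed.

Lemma word_value_surj (l a : nat) : (a < 2 ^ l)%N ->
  exists w, size w = l /\ word_value w = a.
Proof.
elim: l a => [|l IH] a.
  by rewrite expn0 ltnS leqn0 => /eqP ->; exists [::].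
rewrite expnS => al; have [le|lt] := leqP (2 ^ l) a.
  have [|w [sw vw]] := IH (a - 2 ^ l)%N; first by lia.
  by exists (true :: w); rewrite /= sw vw; split=> //; lia.
have [w [sw vw]] := IH a lt.
by exists (false :: w); rewrite /= sw vw.
Qed.

(** The dyadic interval of an extension lies inside that of the word; only its left end matters
    below. *)
Lemma word_value_prefix (R : realFieldType) (p q : bitseq) : prefix p q ->
  ((word_value p)%:R / 2%:R ^+ size p <=
    ((word_value q)%:R / 2%:R ^+ size q : R) <
    (word_value p).+1%:R / 2%:R ^+ size p)%R.
Proof.
have p2 (k : nat) : 0 < (2%:R : R) ^+ k by rewrite exprn_gt0// ltr0n.
case/prefixP => s ->; rewrite word_value_cat size_cat exprD.
have e (x : R) : x / 2%:R ^+ size p = (x * 2%:R ^+ size s) / (2%:R ^+ size p * 2%:R ^+ size s).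
  by rewrite invfM mulrA mulrAC mulfK ?gt_eqF// mulrC.
rewrite !e ler_pM2r ?ltr_pM2r ?invr_gt0 ?mulr_gt0//.
rewrite -!natrX -!natrM ler_nat ltr_nat leq_addr /=.
have := word_value_lt s; lia.
Qed.

(* Shannon-Fano-Elias coding: an interval of length at least [2^-L] contains a
   dyadic interval of length [2^-(L+1)]. *)
Lemma kraft_converse (R : realType) (w : nat -> R) : (forall i, 0 < w i) ->
  (forall N, \sum_(i < N) w i <= 1) ->
  exists s : nat -> bitseq, (forall i j, prefix (s i) (s j) -> i = j) /\
    forall i L, 2%:R ^- L <= w i -> (size (s i) <= L.+1)%N.
Proof.
move=> w0 w1.
have p2 (k : nat) : 0 < (2%:R : R) ^+ k by rewrite exprn_gt0// ltr0n.
have exL i : exists L, 2%:R ^- L <= w i.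
  by have [L /ltW Lw] := pow2_small (w0 i); exists L.
pose L i := ex_minn (exL i).
have Lw i : 2%:R ^- L i <= w i by rewrite /L; case: ex_minnP.
have Lmin i k : 2%:R ^- k <= w i -> (L i <= k)%N.
  by rewrite /L; case: ex_minnP => m _; apply.
(* Index [i] is allotted the interval from [S i] to [S i + w i]. *)
pose S i := \sum_(j < i) w j.
have S0 i : 0 <= S i by apply: sumr_ge0 => j _; exact: ltW.
(* The first dyadic point of level [L i + 1] strictly after [S i]. As the level is one finer than
   [w i], the whole dyadic interval starting there still fits before [S i + w i]. *)
pose a i := (Num.truncn (S i * 2%:R ^+ (L i).+1)).+1.
have a_gt i : S i < (a i)%:R / 2%:R ^+ (L i).+1.
  by rewrite ltr_pdivlMr//; exact: truncnS_gt.
have a_le i : (a i).+1%:R / 2%:R ^+ (L i).+1 <= S i + w i.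
  apply: (@le_trans _ _ (S i + 2%:R ^- L i)); last by rewrite lerD2l.
  rewrite ler_pdivrMr// mulrDl exprS [_ ^- _ * _]mulrCA mulVf ?gt_eqF// mulr1.
  rewrite -exprS /a -natr1 -[X in X%:R]addn1 natrD -addrA lerD// Num.Theory.truncn_le.
  by rewrite mulr_ge0// ltW.
have aL i : (a i < 2 ^ (L i).+1)%N.
  rewrite -(ltr_nat R) natrX -[ltRHS]mul1r -ltr_pdivrMr//.
  apply: lt_le_trans (_ : (a i).+1%:R / 2%:R ^+ (L i).+1 <= _).
    by rewrite ltr_pM2r ?invr_gt0// ltr_nat.
  by apply: le_trans (a_le i) _; have := w1 i.+1; rewrite big_ord_recr.
have /choice[s sP] : forall i, exists u, size u = (L i).+1 /\ word_value u = a i.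
  by move=> i; exact: word_value_surj.
exists s; split; last by move=> i k /Lmin; have [-> _] := sP i; rewrite ltnS.
have mono i j : (i < j)%N -> S i + w i <= S j.
  move=> ij; rewrite /S -(big_mkord xpredT w) -[X in _ <= X](big_mkord xpredT w).
  rewrite (big_cat_nat (leq0n i.+1) ij)/= big_nat_recr//= lerDl.
  by apply: sumr_ge0 => k _; exact: ltW.
have sep i j : (i < j)%N ->
    (a i).+1%:R / (2%:R : R) ^+ (L i).+1 < (a j)%:R / 2%:R ^+ (L j).+1.
  by move=> /mono ij; apply: le_lt_trans (a_gt j); exact: le_trans (a_le i) ij.
move=> i j /(word_value_prefix R).
have [-> ->] := sP i; have [-> ->] := sP j.
case: (ltngtP i j) => // /sep ij /andP[h1 h2].
  by have := lt_trans ij h2; rewrite ltxx.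
have := lt_le_trans ij h1; rewrite ltr_pM2r ?invr_gt0// ltr_nat; lia.
Qed.

(** * Codes of balls and complexities *)

(** Cancellation before arbitrary continuations says that the code is self-delimiting, which is what
    decoding a concatenation needs. *)
Lemma code_nat_catI (m m' : nat) (u u' : bitseq) :
  code_nat m ++ u = code_nat m' ++ u' -> m = m' /\ u = u'.
Proof.
elim: m m' => [|m IH] [|m'] //=; first by case.
by case=> /IH[-> ->].
Qed.

Lemma code_int_catI (z z' : int) (u u' : bitseq) :
  code_int z ++ u = code_int z' ++ u' -> z = z' /\ u = u'.
Proof. by case=> + /code_nat_catI[+ ->] => ? ?; split => //; lia. Qed.

Lemma code_rat_catI (q q' : rat) (u u' : bitseq) :
  code_rat q ++ u = code_rat q' ++ u' -> q = q' /\ u = u'.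
Proof.
rewrite /code_rat -!catA => /code_int_catI[nq /code_int_catI[dq ->]]; split => //.
by rewrite -(divq_num_den q) -(divq_num_den q') nq dq.
Qed.

Lemma code_ball_inj (n : nat) : injective (@code_ball n).
Proof.
move=> [c r r0] [c' r' r'0]; rewrite /code_ball /=.
rewrite -(cats0 (code_rat r)) -(cats0 (code_rat r')) => e.
suff [ec er] : c = c' /\ code_rat r ++ [::] = code_rat r' ++ [::].
  by move: r0 r'0; rewrite ec; have [-> _] := code_rat_catI er => r0 r'0;
    rewrite (bool_irrelevance r0 r'0).
(* Generalised from the enumeration of all coordinates to any list of them, for induction. *)
suff H (s : seq 'I_n) u u' :
    flatten [seq code_rat (c ord0 i) | i <- s] ++ u =
    flatten [seq code_rat (c' ord0 i) | i <- s] ++ u' ->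
    {in s, forall i, c ord0 i = c' ord0 i} /\ u = u'.
  have [ec ->] := H _ _ _ e; split=> //; apply/rowP => i.
  by apply: ec; rewrite mem_enum.
elim: s => [|i s IH] // h.
have {h}[ei /IH[es ->]] :=
  code_rat_catI (etrans (catA _ _ _) (etrans h (esym (catA _ _ _)))).
by split => // j; rewrite inE => /predU1P[->|/es].
Qed.

Lemma outputs_ball_inj (n : nat) (M : otm) (A : set nat) (p : bitseq)
    (b b' : rat_ball n) :
  outputs_ball M A p b -> outputs_ball M A p b' -> b = b'.
Proof. by move=> h h'; apply: code_ball_inj; exact: outputs_word_inj h h'. Qed.

Lemma min_length_le (R : realType) (S : set bitseq) (p : bitseq) :
  S p -> (min_length R S <= (size p)%:R%:E)%E.
Proof. by move=> Sp; apply: ereal_inf_lbound; exists p. Qed.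

Lemma min_length_lt (R : realType) (S : set bitseq) (x : \bar R) :
  (min_length R S < x)%E -> exists2 p, S p & ((size p)%:R%:E < x)%E.
Proof. by move=> /ereal_inf_lt[_ [p Sp <-] px]; exists p. Qed.

Lemma min_length_ge0 (R : realType) (S : set bitseq) : (0 <= min_length R S)%E.
Proof. by apply: le_ereal_inf_tmp => _ [p _ <-]; rewrite lee_fin. Qed.

(** * From prefix codes and weights to oracles *)

Lemma printer_ball_machine (n : nat) (b : rat_ball n) :
  ball_machine n (printer (code_ball b)).
Proof.
have b0 : (0 < size (code_ball b))%N.
  by rewrite /code_ball size_cat /code_rat size_cat addnCA.
split=> [A p q /printer_dom -> // /printer_dom ->//|A p /printer_dom ->//].
by exists b; exact: printer_outputs.
Qed.

(** A printer outputs [b] on the empty word, so optimality makes the complexity of [b] under [U]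
    finite. *)
Lemma optimal_surj (R : realType) (n : nat) (U : otm) (b : rat_ball n) :
  optimal R n U -> exists p, outputs_ball U set0 p b.
Proof.
move=> [_ /(_ _ (printer_ball_machine b))[c /(_ set0 b) Uc]].
have b0 : (0 < size (code_ball b))%N.
  by rewrite /code_ball size_cat /code_rat size_cat addnCA.
have : (ball_K R U set0 b < +oo)%E.
  apply: le_lt_trans Uc _.
  have : (ball_K R (printer (code_ball b)) set0 b <= 0%:E)%E.
    by apply: (@min_length_le _ _ [::]); exact: printer_outputs.
  move=> h; apply: (@le_lt_trans _ _ (0%:E + c%:R%:E)%E); first by rewrite leeD2r.
  by rewrite -EFinD ltry.
by move=> /min_length_lt[p]; exists p.
Qed.

(** The table pairs [s i] with any program of [U] for [b i] under the empty oracle. Only the key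
    [s i] is charged for; [c] is the optimality constant for [lookup U]. *)
Lemma coding_of_prefix_code (R : realType) (n : nat) (U : otm) :
  optimal R n U -> forall (b : nat -> rat_ball n) (s : nat -> bitseq),
  (forall i j, prefix (s i) (s j) -> i = j) ->
  exists (A : set nat) (c : nat), forall i,
    (ball_K R U A (b i) <= (size (s i) + c)%:R%:E)%E.
Proof.
move=> optU b s sfree.
have /choice[t tb] : forall i, exists p, outputs_ball U set0 p (b i).
  by move=> i; exact: optimal_surj optU.
have [A HA] := lookup_table U t sfree.
have [c Hc] := optU.2 _ (lookup_ball_machine optU.1).
exists A, c => i; apply: le_trans (Hc A (b i)) _.
rewrite natrD EFinD leeD2r//.
by apply: min_length_le; apply: HA; exact: tb.
Qed.

Lemma sum_geometric_half (R : realFieldType) (N : nat) :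
  \sum_(i < N) (2%:R : R) ^- i.+1 = 1 - 2%:R ^- N.
Proof.
elim: N => [|N IH]; first by rewrite big_ord0 expr0 invr1 subrr.
rewrite big_ord_recr IH /= exprS invfM.
have : (2%:R : R) ^- N = 2%:R ^- N by []. set x := _ ^- N; lra.
Qed.

Lemma coding_of_weights (R : realType) (n : nat) (U : otm) :
  optimal R n U -> forall (b : nat -> rat_ball n) (w : nat -> R),
  (forall i, 0 <= w i) -> (forall N, \sum_(i < N) w i <= 1) ->
  exists (A : set nat) (c : nat), forall i L, 2%:R ^- L <= w i ->
    (ball_K R U A (b i) <= (L + c)%:R%:E)%E.
Proof.
move=> optU b w w0 w1.
have p2 (k : nat) : 0 < (2%:R : R) ^- k by rewrite invr_gt0 exprn_gt0// ltr0n.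
(* Mixing with a geometric series makes the weights positive and keeps the total at most 1, at the
   cost of one bit. The second bit in [c.+2] is the rounding in [kraft_converse]. *)
pose w' i := (w i + 2%:R ^- i.+1) / 2%:R.
have [||s [sfree sL]] := @kraft_converse R w'.
- by move=> i; rewrite divr_gt0// ltr_wpDl.
- move=> N; rewrite -mulr_suml big_split /= sum_geometric_half.
  have := w1 N; have := p2 N; lra.
have [A [c HA]] := coding_of_prefix_code optU b sfree.
exists A, c.+2 => i L Lw; apply: le_trans (HA i) _.
rewrite lee_fin ler_nat -!addSnnS leq_add2r; apply: sL.
rewrite exprS invfM /w'; have := p2 i.+1; lra.
Qed.

Lemma sum_le_esum (R : realType) (T : choiceType) (f : T -> \bar R) (s : seq T) :
  uniq s -> (\sum_(t <- s) f t <= \esum_(t in setT) f t)%E.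
Proof.
move=> us; apply: esum_ge; exists [set` s]; first by split.
by rewrite fsbig_seq.
Qed.

Lemma coding_of_summable (R : realType) (n : nat) (U : otm) :
  optimal R n U -> forall (T : countType) (b : T -> rat_ball n) (w : T -> R),
  (forall t, 0 <= w t) -> (\esum_(t in setT) (w t)%:E <= 1)%E ->
  exists (A : set nat) (c : nat), forall t L, 2%:R ^- L <= w t ->
    (ball_K R U A (b t) <= (L + c)%:R%:E)%E.
Proof.
move=> optU T b w w0 w1.
(* Numbers coding no element of [T] get weight 0 and this dummy ball. *)
pose b0 : rat_ball n := RatBall 0 ltr01.
pose b' i := oapp b b0 (pickle_inv i).
pose w' i := oapp w 0 (pickle_inv i).
have [||A [c HA]] := @coding_of_weights R n U optU b' w'.
- by move=> i; rewrite /w'; case: pickle_inv.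
- move=> N; rewrite -lee_fin; apply: le_trans w1.
  apply: le_trans (sum_le_esum (s := pmap pickle_inv (iota 0 N)) _ _); last first.
    by apply: pmap_uniq (iota_uniq _ _); exact: pickle_invK.
  rewrite sumEFin lee_fin -(big_mkord xpredT w') /index_iota subn0.
  elim: (iota 0 N) => [|i s IH] /=; first by rewrite !big_nil.
  rewrite big_cons /w'; case: (pickle_inv _) => [t|] /=; last by rewrite add0r.
  by rewrite big_cons lerD2l.
exists A, c => t L Lw; have := HA (pickle t) L.
by rewrite /b' /w' pickleK_inv; apply.
Qed.

(** * Euclidean geometry *)

(** The sum of the squares [(A b_i - C a_i)^2] equals [A (A B - C^2)]; if [A = 0], all [a_i]
    vanish. *)
Lemma cauchy_schwarz (R : realFieldType) (n : nat) (a b : 'I_n -> R) :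
  (\sum_i a i * b i) ^+ 2 <= (\sum_i a i ^+ 2) * (\sum_i b i ^+ 2).
Proof.
set A := \sum_i a i ^+ 2; set B := \sum_i b i ^+ 2; set C := \sum_i a i * b i.
have A0 : 0 <= A by apply: sumr_ge0 => i _; exact: sqr_ge0.
have : 0 <= \sum_i (A * b i - C * a i) ^+ 2.
  by apply: sumr_ge0 => i _; exact: sqr_ge0.
have -> : \sum_i (A * b i - C * a i) ^+ 2 = A * (A * B - C ^+ 2).
  transitivity (\sum_i (A ^+ 2 * b i ^+ 2 - 2 * A * C * (a i * b i) + C ^+ 2 * a i ^+ 2)).
    by apply: eq_bigr => i _; ring.
  by rewrite big_split /= sumrB -!mulr_sumr -/A -/B -/C; ring.
move: A0; rewrite le_eqVlt => /predU1P[A0 _|A0].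
  suff -> : C = 0 by rewrite expr0n -A0 mul0r.
  apply: big1 => i _; suff /eqP -> : a i == 0 by rewrite mul0r.
  rewrite -sqrf_eq0; apply/eqP/(psumr_eq0P (P := predT) (F := fun i => a i ^+ 2)) => // j _.
  exact: sqr_ge0.
by rewrite pmulr_rge0// subr_ge0.
Qed.

Section Euclid.
Variables (R : realType) (n : nat).
Implicit Types (x y z : 'rV[R]_n) (S : set 'rV[R]_n).

Lemma eucl_dist_ge0 x y : 0 <= eucl_dist x y.
Proof. exact: sqrtr_ge0. Qed.

Lemma eucl_distC x y : eucl_dist x y = eucl_dist y x.
Proof.
by congr Num.sqrt; apply: eq_bigr => i _; rewrite -sqrrN opprB.
Qed.

Lemma eucl_distxx x : eucl_dist x x = 0.
Proof. by rewrite /eucl_dist big1 ?sqrtr0// => i _; rewrite subrr expr0n. Qed.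

Lemma eucl_dist_triangle y x z : eucl_dist x z <= eucl_dist x y + eucl_dist y z.
Proof.
have sum0 u v : 0 <= \sum_(i < n) ((u : 'rV[R]_n) ord0 i - v ord0 i) ^+ 2.
  by apply: sumr_ge0 => i _; exact: sqr_ge0.
rewrite -(@ler_pXn2r _ 2)// ?nnegrE ?addr_ge0 ?eucl_dist_ge0//.
rewrite sqrrD !sqr_sqrtr//.
set a := fun i => x ord0 i - y ord0 i; set b := fun i => y ord0 i - z ord0 i.
have -> : \sum_i (x ord0 i - z ord0 i) ^+ 2 =
    \sum_i a i ^+ 2 + (\sum_i a i * b i) *+ 2 + \sum_i b i ^+ 2.
  rewrite -sumrMnl -!big_split /=; apply: eq_bigr => i _.
  by rewrite -sqrrD /a /b addrA subrK.
rewrite lerD2r lerD2l lerMn2r /=.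
apply: le_trans (ler_norm _) _.
rewrite -(@ler_pXn2r _ 2)// ?nnegrE ?mulr_ge0 ?eucl_dist_ge0//.
by rewrite real_normK ?num_real// exprMn !sqr_sqrtr//; exact: cauchy_schwarz.
Qed.

Lemma eucl_diam_ge S x y : S x -> S y -> ((eucl_dist x y)%:E <= eucl_diam S)%E.
Proof. by move=> Sx Sy; apply: ereal_sup_ubound; exists x, y. Qed.

Lemma eucl_diam_le S (d : \bar R) :
  (forall x y, S x -> S y -> ((eucl_dist x y)%:E <= d)%E) -> (eucl_diam S <= d)%E.
Proof. by move=> H; apply: ge_ereal_sup => _ [x [y [Sx Sy ->]]]; exact: H. Qed.

Lemma eucl_diam_cball_le x (r : R) : (eucl_diam (eucl_cball x r) <= (r *+ 2)%:E)%E.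
Proof.
apply: eucl_diam_le => y z xy xz; rewrite lee_fin mulr2n.
by apply: le_trans (eucl_dist_triangle x _ _) _; rewrite lerD// eucl_distC.
Qed.

(** Witnessed by the center and its translate by [r] along the first axis, which exists as [n >= 1].
    The factor 2 lost here is harmless. *)
Lemma eucl_diam_cball_ge x (r : R) : (1 <= n)%N -> 0 <= r ->
  (r%:E <= eucl_diam (eucl_cball x r))%E.
Proof.
case: n x => // m x _ r0.
pose y : 'rV[R]_m.+1 := x + r *: delta_mx 0 ord0.
have xy : eucl_dist x y = r.
  rewrite /eucl_dist (bigD1 ord0)//= big1 => [|i i0].
    rewrite !mxE !eqxx mulr1 opprD addNKr sqrrN addr0 sqrtr_sqr ger0_norm//.
  by rewrite !mxE (negbTE i0) andbF mulr0 addr0 subrr expr0n.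
rewrite -[X in (X%:E <= _)%E]xy; apply: ereal_sup_ubound; exists x, y; split => //.
- by rewrite /eucl_cball /= /eucl_dist big1 ?sqrtr0// => i _; rewrite subrr expr0n.
- by rewrite /eucl_cball /= xy.
Qed.

(** Each coordinate is approximated within [e / n], and the [n] squares add up to [e^2 / n]. *)
Lemma rat_approx x (e : R) : (1 <= n)%N -> 0 < e ->
  exists q : 'rV[rat]_n, eucl_dist (map_mx ratr q) x <= e.
Proof.
move=> n1 e0; have n0 : 0 < (n%:R : R) by rewrite ltr0n.
have d0 : 0 < e / n%:R by rewrite divr_gt0.
have /choice[q qx] : forall i, exists q : rat,
    `|ratr q - x ord0 i| <= e / n%:R.
  move=> i; have [|q] := @rat_in_itvoo R (x ord0 i - e / n%:R) (x ord0 i + e / n%:R).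
    lra.
  rewrite in_itv /= => /andP[h1 h2]; exists q.
  by rewrite ler_norml; apply/andP; split; lra.
exists (\row_i q i); rewrite /eucl_dist.
apply: (@le_trans _ _ (Num.sqrt (e ^+ 2))); last by rewrite sqrtr_sqr ger0_norm// ltW.
apply: ler_wsqrtr.
apply: (@le_trans _ _ (\sum_(i < n) (e / n%:R) ^+ 2)).
  apply: ler_sum => i _; rewrite !mxE -[leLHS]real_normK ?num_real//.
  by rewrite ler_pXn2r// nnegrE ?normr_ge0// ltW.
have -> : \sum_(i < n) (e / n%:R) ^+ 2 = e ^+ 2 * n%:R^-1.
  by rewrite sumr_const card_ord -mulr_natr; field; rewrite gt_eqF.
rewrite -[leRHS]mulr1; apply: ler_wpM2l; first exact: sqr_ge0.
by rewrite invf_le1// ler1n.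
Qed.

(** The center is moved by at most [2^-(r+2)] and the radius is [2^-(r+1)], which leaves room
    [2^-(r+2)] around [x]. *)
Lemma rat_ball_around x (r : nat) : (1 <= n)%N ->
  exists b : rat_ball n,
    (forall y, eucl_dist x y <= 2%:R ^- r.+2 -> ball_set R b y) /\
    (eucl_diam (ball_set R b) <= (2%:R ^- r)%:E)%E.
Proof.
move=> n1; have p0 (K : numFieldType) k : 0 < (2%:R : K) ^- k.
  by rewrite invr_gt0 exprn_gt0// ltr0n.
have [q qx] := rat_approx x n1 (p0 R r.+2).
have er : ratr (2%:R ^- r.+1) = 2%:R ^- r.+1 :> R.
  by rewrite fmorphV rmorphXn /= ratr_nat.
have e2 : (2%:R : R) ^- r.+1 = 2%:R ^- r.+2 *+ 2.
  by rewrite [2%:R ^+ r.+2]exprS invfM; lra.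
exists (RatBall q (p0 _ r.+1)); rewrite /ball_set /= er; split.
  move=> y xy; rewrite /eucl_cball /= e2 mulr2n.
  by apply: le_trans (eucl_dist_triangle x _ _) _; exact: lerD.
apply: le_trans (eucl_diam_cball_le _ _) _.
by rewrite lee_fin exprS invfM; lra.
Qed.

End Euclid.

Lemma dyadic_scale (R : realType) (d : R) (m : nat) : 0 < d -> d <= 2%:R ^- m ->
  exists r, [/\ (m <= r)%N, d <= 2%:R ^- r & 2%:R ^- r.+1 < d].
Proof.
move=> d0 dm.
(* The required [r] is the predecessor of the least [L] with [2^-L < d]. *)
case: (ex_minnP (pow2_small d0)) => L hL Lmin.
have mL : (m < L)%N.
  rewrite ltnNge; apply/negP => Lm.
  have := lt_le_trans hL dm; rewrite ltf_pV2 ?posrE ?exprn_gt0// ltr_eXn2l ?ltr1n//.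
  by rewrite ltnNge Lm.
case: L hL Lmin mL => // r hL Lmin mr; exists r; split => //.
by rewrite leNgt; apply/negP => /Lmin; rewrite ltnn.
Qed.

(** * Limits *)

Section Limits.
Local Open Scope ereal_scope.

Lemma limn_einf_lt (R : realType) (u : (\bar R)^nat) (a : \bar R) (N : nat) :
  limn_einf u < a -> exists2 m, (N <= m)%N & u m < a.
Proof.
rewrite limn_einf_lim (cvg_lim _ (@cvg_einfs_sup _ u))// => ua.
have : einfs u N < a.
  by apply: le_lt_trans ua; apply: ereal_sup_ubound; exists N.
by move=> /ereal_inf_lt[_ [m /= Nm <-]]; exists m.
Qed.

Lemma limn_einf_le (R : realType) (u : (\bar R)^nat) (a : \bar R) :
  (forall N, exists2 m, (N <= m)%N & u m <= a) -> limn_einf u <= a.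
Proof.
move=> ua; rewrite limn_einf_lim (cvg_lim _ (@cvg_einfs_sup _ u))//.
apply: ge_ereal_sup => _ [N _ <-]; have [m Nm um] := ua N.
by apply: le_trans um; apply: ereal_inf_lbound; exists m.
Qed.

Lemma limn_esup_lt (R : realType) (u : (\bar R)^nat) (a : \bar R) :
  limn_esup u < a -> exists N, forall m, (N <= m)%N -> u m < a.
Proof.
rewrite limn_esup_lim (cvg_lim _ (@cvg_esups_inf _ u))//.
move=> /ereal_inf_lt[_ [N _ <-] uN]; exists N => m Nm.
by apply: le_lt_trans uN; apply: ereal_sup_ubound; exists m.
Qed.

Lemma limn_esup_le (R : realType) (u : (\bar R)^nat) (a : \bar R) (N : nat) :
  (forall m, (N <= m)%N -> u m <= a) -> limn_esup u <= a.
Proof.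
move=> ua; rewrite limn_esup_lim (cvg_lim _ (@cvg_esups_inf _ u))//.
apply: (@le_trans _ _ (esups u N)).
  by apply: ereal_inf_lbound; exists N.
by apply: ge_ereal_sup => _ [m /= Nm <-]; exact: ua.
Qed.

End Limits.

(** * Hausdorff and packing measures without limits *)

Section Measures.
Local Open Scope ereal_scope.
Variables (R : realType) (n : nat).
Implicit Types (s d : R) (E : set 'rV[R]_n).

Lemma hausdorff_content_ge0 s E d : 0 <= hausdorff_content s E d.
Proof.
apply: le_ereal_inf_tmp => _ [D [V [_ _ ->]]].
by apply: esum_ge0 => i _; exact: poweR_ge0.
Qed.

(** A smaller [delta] admits fewer covers, so the content increases as [delta] decreases to 0. *)
Lemma hausdorff_measureE s E :
  hausdorff_measure s E = ereal_sup [set hausdorff_content s E d | d in [set d | (0 < d)%R]].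
Proof.
have -> : [set d : R | (0 < d)%R] = [set` `]0%R, +oo[].
  by apply/seteqP; split => d /=; rewrite in_itv /= andbT.
apply: cvg_lim => //.
apply: (@nonincreasing_at_right_cvge _ (hausdorff_content s E) 0%R +oo%O) => // d d' _ _ dd'.
apply: ereal_inf_le_tmp => _ [D [V [EV Vd ->]]]; exists D, V; split=> // i Di.
have /andP[-> h] := Vd i Di.
by apply: le_trans h _; rewrite lee_fin.
Qed.

Lemma hausdorff_measure_eq0 s E :
  (forall d, (0 < d)%R -> hausdorff_content s E d <= 0) -> hausdorff_measure s E = 0.
Proof.
move=> H; rewrite hausdorff_measureE; apply/eqP; rewrite eq_le; apply/andP; split.
  by apply: ge_ereal_sup => _ [d /= d0 <-]; exact: H.
apply: le_trans (hausdorff_content_ge0 s E 1%R) _.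
by apply: ereal_sup_ubound; exists 1%R => //=; rewrite ltr01.
Qed.

Lemma hausdorff_content_eq0 s E d : hausdorff_measure s E = 0 -> (0 < d)%R ->
  hausdorff_content s E d = 0.
Proof.
move=> H d0; apply/eqP; rewrite eq_le hausdorff_content_ge0 andbT -H hausdorff_measureE.
by apply: ereal_sup_ubound; exists d.
Qed.

Lemma packing_content_ge0 s E d : 0 <= packing_content s E d.
Proof.
apply: ereal_sup_ubound; exists set0, (fun=> 0%R), (fun=> 0%R); split=> //.
by rewrite esum_set0.
Qed.

(** A smaller [delta] admits fewer packings, so here the content decreases with [delta]. *)
Lemma packing_premeasureE s E :
  packing_premeasure s E = ereal_inf [set packing_content s E d | d in [set d | (0 < d)%R]].
Proof.
have -> : [set d : R | (0 < d)%R] = [set` `]0%R, +oo[].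
  by apply/seteqP; split => d /=; rewrite in_itv /= andbT.
apply: cvg_lim => //.
apply: (@nondecreasing_at_right_cvge _ (packing_content s E) 0%R +oo%O) => // d d' _ _ dd'.
apply: ereal_sup_le => _ [D [c [r [cr tr ->]]]]; exists D, c, r; split=> // i Di.
have [Ec /andP[-> h]] := cr i Di; split => //.
exact: le_trans h _.
Qed.

Lemma packing_premeasure_ge0 s E : 0 <= packing_premeasure s E.
Proof.
rewrite packing_premeasureE; apply: le_ereal_inf_tmp => _ [d _ <-].
exact: packing_content_ge0.
Qed.

Lemma packing_premeasure_lt s E (a : \bar R) : packing_premeasure s E < a ->
  exists2 d, (0 < d)%R & packing_content s E d < a.
Proof.
by rewrite packing_premeasureE => /ereal_inf_lt[_ [d /= d0 <-]]; exists d.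
Qed.

Lemma packing_premeasure_eq0 s E :
  (forall e : R, (0 < e)%R -> exists2 d, (0 < d)%R & packing_content s E d <= e%:E) ->
  packing_premeasure s E = 0.
Proof.
move=> H; apply/eqP; rewrite eq_le packing_premeasure_ge0 andbT.
apply/lee_addgt0Pr => e e0; rewrite add0e packing_premeasureE.
have [d d0 hd] := H e e0.
by apply: ge_ereal_inf; exists (packing_content s E d) => //; exists d.
Qed.

Lemma packing_measure_eq0 s E (F : nat -> set 'rV[R]_n) :
  E `<=` \bigcup_j F j -> (forall j, packing_premeasure s (F j) = 0) ->
  packing_measure s E = 0.
Proof.
move=> EF F0; apply/eqP; rewrite eq_le; apply/andP; split.
  apply: ereal_inf_lbound; exists F; split=> //.
  by rewrite eseries0.
apply: le_ereal_inf_tmp => _ [G [_ ->]].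
by apply: nneseries_ge0 => j _ _; exact: packing_premeasure_ge0.
Qed.

(** Each premeasure is a term of a nonnegative series with sum below 1. The bound 1 later limits the
    number of separated points. *)
Lemma packing_measure_cover s E : packing_measure s E = 0 ->
  exists F : nat -> set 'rV[R]_n, E `<=` \bigcup_j F j /\
    forall j, packing_premeasure s (F j) < 1.
Proof.
move=> E0; have : packing_measure s E < 1 by rewrite E0 lte01.
move=> /ereal_inf_lt[_ [F [EF ->]] F1]; exists F; split=> // j.
apply: le_lt_trans F1.
apply: le_trans (nneseries_lim_ge j.+1 _); last first.
  by move=> i _ _; exact: packing_premeasure_ge0.
rewrite big_nat_recr//= leeDr// sume_ge0// => i _.
exact: packing_premeasure_ge0.
Qed.

End Measures.

(** * Covers and packings from programs *)

(** Kraft's inequality on finite subfamilies; both lower bounds are reduced to it by attaching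
    programs to covering sets or to packing balls. *)
Lemma esum_le_kraft (R : realType) (T : choiceType) (D : set T) (p : T -> bitseq)
    (f : T -> \bar R) (e : R) : 0 <= e ->
  (forall i j, D i -> D j -> prefix (p i) (p j) -> i = j) ->
  (forall i, D i -> (f i <= (e * 2%:R ^- size (p i))%:E)%E) ->
  (\esum_(i in D) f i <= e%:E)%E.
Proof.
move=> e0 pD fD; apply: ge_ereal_sup => _ [X [finX XD] <-].
have [s0 Xs0] := (finite_seqP X).1 finX.
pose s := undup s0.
have memX i : i \in s -> D i.
  by rewrite mem_undup => si; apply: XD; rewrite Xs0.
have -> : X = [set` s] by rewrite Xs0; apply/seteqP; split => i /=; rewrite mem_undup.
rewrite -fsbig_seq ?undup_uniq//.
apply: (@le_trans _ _ (\sum_(i <- s) (e * 2%:R ^- size (p i))%:E)%E).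
  by rewrite big_seq [leRHS]big_seq; apply: lee_sum => i /memX; exact: fD.
rewrite sumEFin lee_fin -mulr_sumr -[leRHS]mulr1 ler_wpM2l//.
rewrite -(big_map p predT (fun q => 2%:R ^- size q)); apply: kraft.
  rewrite map_inj_in_uniq ?undup_uniq// => i j /memX Di /memX Dj e'.
  by apply: pD => //; rewrite e' prefix_refl.
by move=> _ _ /mapP[i /memX Di ->] /mapP[j /memX Dj ->] /pD ->.
Qed.

Section Lower.
Variables (R : realType) (n : nat) (U : otm).
Hypothesis n1 : (1 <= n)%N.
Hypothesis ballU : ball_machine n U.
Implicit Types (A : set nat) (E : set 'rV[R]_n) (x : 'rV[R]_n).

Lemma outputs_prefix_free A p q (b b' : rat_ball n) :
  outputs_ball U A p b -> outputs_ball U A q b' -> prefix p q -> p = q.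
Proof.
by move=> [c hc _] [c' hc' _]; apply: (ballU.1 A); [exists c|exists c'].
Qed.

Lemma point_K_ratio_lt A x (m : nat) (s : R) : (0 < m)%N ->
  (point_K_ratio U A x m < s%:E)%E ->
  exists p (b : rat_ball n), [/\ outputs_ball U A p b, ball_set R b x,
    (eucl_diam (ball_set R b) <= (2%:R ^- m)%:E)%E & (size p)%:R <= s * m%:R].
Proof.
move=> m0; rewrite /point_K_ratio lte_pdivrMr ?ltr0n// -EFinM.
move=> /min_length_lt[p [b [pb bx bm]]]; rewrite lte_fin => pm.
by exists p, b; split => //; exact: ltW.
Qed.

Lemma hausdorff_measure_eq0_of_einf A E (s0 s : R) : 0 < s0 -> s0 < s ->
  (forall x, E x -> (limn_einf (point_K_ratio U A x) < s0%:E)%E) ->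
  hausdorff_measure s E = 0%E.
Proof.
move=> s00 s0s HE; apply: hausdorff_measure_eq0 => d d0.
apply/lee_addgt0Pr => e e0; rewrite add0e.
have [N1 N1d] := pow2_small d0.
have ss0 : 0 < s - s0 by rewrite subr_gt0.
(* [N] is large enough both for the diameters to be at most [d] and for the factor [2^(-N(s-s0))] to
   be at most [e]. *)
have [N N1N Ne] := pow2_powR_small N1.+1 ss0 e0.
pose good (p : bitseq) (b : rat_ball n) := exists2 m, (N <= m)%N &
  [/\ outputs_ball U A p b, (eucl_diam (ball_set R b) <= (2%:R ^- m)%:E)%E &
      (size p)%:R <= s0 * m%:R].
(* Covers are indexed by numbers, so each covering set is indexed by the code of its program. *)
pose prog (i : nat) : bitseq := odflt [::] (unpickle i).
pose D := [set i : nat | exists2 p, i = pickle p & exists b, good p b].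
pose V (i : nat) := [set x : 'rV[R]_n | exists2 b, outputs_ball U A (prog i) b & ball_set R b x].
have progK p : prog (pickle p) = p by rewrite /prog pickleK.
have Vball p b : outputs_ball U A p b -> V (pickle p) = ball_set R b.
  move=> pb; apply/seteqP; split=> [x [b' + b'x]|x bx].
    by rewrite progK => pb'; rewrite (outputs_ball_inj pb pb').
  by exists b => //; rewrite progK.
apply: (@le_trans _ _ (\esum_(i in D) (eucl_diam (V i) `^ s))%E).
  apply: ereal_inf_lbound; exists D, V; split=> //.
  - move=> x /HE /(limn_einf_lt N)[m Nm].
    have m0 : (0 < m)%N by apply: leq_trans Nm; exact: leq_trans N1N.
    move=> /(point_K_ratio_lt m0)[p [b [pb bx bm pm]]].
    exists (pickle p); last by rewrite (Vball p b).
    by exists p => //; exists b, m.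
  - move=> _ [p -> [b [m Nm [pb bm pm]]]]; rewrite (Vball p b)//; apply/andP; split.
      apply: lt_le_trans (eucl_diam_cball_ge _ n1 _).
        by rewrite lte_fin ltr0q rb_radius_gt0.
      by rewrite ler0q ltW// rb_radius_gt0.
    apply: le_trans bm _; rewrite lee_fin; apply: le_trans (ltW N1d).
    rewrite lef_pV2 ?posrE ?exprn_gt0// ler_eXn2l ?ltr1n//.
    exact: leq_trans (ltnW N1N) Nm.
apply: (esum_le_kraft (p := prog)); first exact: ltW.
  move=> _ _ [p -> [b [m _ [pb _ _]]]] [q -> [b' [m' _ [qb' _ _]]]].
  by rewrite !progK => pq; congr pickle; exact: outputs_prefix_free pb qb' pq.
move=> _ [p -> [b [m Nm [pb bm pm]]]]; rewrite (Vball p b)// progK.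
apply: (@le_trans _ _ ((2%:R ^- m)%:E `^ s)%E).
  apply: gt0_ler_poweR => //; first by rewrite ltW// (lt_trans s00).
  - rewrite in_itv /= leey andbT; apply: le_trans (eucl_diam_cball_ge _ n1 _);
      by rewrite ?lee_fin ler0q ltW// rb_radius_gt0.
  - by rewrite in_itv /= leey andbT lee_fin ltW// pow2N_gt0.
rewrite poweR_EFin lee_fin; apply: le_trans (scale_estimate s0s Nm pm) _.
by rewrite ler_wpM2r// ltW// pow2N_gt0.
Qed.

Lemma packing_measure_eq0_of_esup A E (s0 s : R) : 0 < s0 -> s0 < s ->
  (forall x, E x -> (limn_esup (point_K_ratio U A x) < s0%:E)%E) ->
  packing_measure s E = 0%E.
Proof.
move=> s00 s0s HE; have sgt0 := lt_trans s00 s0s.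
(* Pieces of [E] on which the complexity bound holds from a common scale on. *)
pose F j := [set x | E x /\ forall m, (j < m)%N -> (point_K_ratio U A x m < s0%:E)%E].
apply: (@packing_measure_eq0 _ _ _ _ F).
  move=> x Ex; have [N HN] := limn_esup_lt (HE x Ex).
  by exists N => //; split=> // m Nm; apply: HN; exact: ltnW.
move=> j; apply: packing_premeasure_eq0 => e e0.
have c0 : 0 < (4%:R : R) `^ s by rewrite powR_gt0.
have ss0 : 0 < s - s0 by rewrite subr_gt0.
(* The factor [4^s] is paid for here: packing balls have diameter at most [4 * 2^-m] at the scale
   [m] chosen below. *)
have [N jN Ne] := pow2_powR_small j ss0 (divr_gt0 e0 c0).
exists (2%:R ^- N); first exact: pow2N_gt0.
apply: ge_ereal_sup => _ [D [c [r [cr tr ->]]]].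
have /choice[p Hp] : forall i, exists p : bitseq, D i -> exists m (b : rat_ball n),
    [/\ (N <= m)%N, r i *+ 2 <= 4%:R * 2%:R ^- m, outputs_ball U A p b, ball_set R b (c i) &
      (eucl_diam (ball_set R b) <= (r i)%:E)%E /\ (size p)%:R <= s0 * m%:R].
  move=> i; have [Di|nDi] := pselect (D i); last by exists [::].
  have [[_ Fc] /andP[r0 rN]] := cr i Di.
  have [k [Nk rk kr]] := dyadic_scale r0 rN.
  have jk : (j < k.+1)%N by rewrite ltnS (leq_trans jN).
  (* At scale [k + 1] the output ball has diameter below the radius [r i], hence lies inside the
     packing ball. *)
  have [q [b [qb bc bk qk]]] := point_K_ratio_lt (ltn0Sn k) (Fc _ jk).
  exists q => _; exists k.+1, b; split=> //.
  - by rewrite ltnW// ltnS.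
  - by rewrite exprS invfM; lra.
  - by split=> //; apply: le_trans bk _; rewrite lee_fin ltW.
apply: (esum_le_kraft (p := p)); first exact: ltW.
  move=> i i' Di Di'; have [m [b [_ _ pb bc [br _]]]] := Hp i Di.
  have [m' [b' [_ _ pb' bc' _]]] := Hp i' Di'.
  move=> /(outputs_prefix_free pb pb') epp; rewrite -epp in pb'.
  rewrite -(outputs_ball_inj pb pb') in bc'.
  (* With equal programs the same small ball contains both centers, so [c i'] lies in both packing
     balls. *)
  apply: (tr i i' Di Di'); exists (c i'); split.
    rewrite /eucl_cball /= -lee_fin; apply: le_trans br.
    exact: eucl_diam_ge.
  rewrite /eucl_cball /= eucl_distxx.
  by have [_ /andP[/ltW]] := cr i' Di'.
move=> i Di; have [m [b [Nm rm _ _ [_ pm]]]] := Hp i Di.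
have [_ /andP[ri0 _]] := cr i Di.
apply: (@le_trans _ _ ((4%:R * 2%:R ^- m)%:E `^ s)%E).
  apply: gt0_ler_poweR => //; first exact: ltW.
  - rewrite in_itv /= leey andbT; apply: le_trans (eucl_diam_cball_ge _ n1 _);
      by rewrite ?lee_fin ltW.
  - by rewrite in_itv /= leey andbT lee_fin mulr_ge0 ?ler0n ?ltW ?pow2N_gt0.
  - by apply: le_trans (eucl_diam_cball_le _ _) _; rewrite lee_fin.
rewrite poweR_EFin lee_fin powRM ?ler0n ?(ltW (pow2N_gt0 _ _))//.
rewrite -ler_pdivlMl//; apply: le_trans (scale_estimate s0s Nm pm) _.
rewrite mulrA [_^-1 * e]mulrC ler_wpM2r// ltW// pow2N_gt0//.
Qed.

End Lower.

(** * Complexity bounds from covers *)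

Lemma esum_nat_le (R : realType) (f : nat -> R) (c : R) : (forall i, 0 <= f i) ->
  (forall N, \sum_(i < N) f i <= c) -> (\esum_(i in setT) (f i)%:E <= c%:E)%E.
Proof.
move=> f0 fc; rewrite -nneseries_esumT => [|i]; last by rewrite lee_fin.
apply: lime_le; first by apply: is_cvg_nneseries => i _ _; rewrite lee_fin.
by apply: nearW => N; rewrite big_mkord sumEFin lee_fin.
Qed.

Lemma esum_initial_segment (R : realType) (N : nat) (c : R) : 0 <= c ->
  (\esum_(i in setT) (if (i < N)%N then c else 0)%:E <= (N%:R * c)%:E)%E.
Proof.
move=> c0; apply: esum_nat_le => [i|M]; first by case: ifP.
suff -> : \sum_(i < M) (if (i < N)%N then c else 0) = (minn M N)%:R * c.
  by rewrite ler_wpM2r// ler_nat geq_minr.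
elim: M => [|M IH]; first by rewrite big_ord0 min0n mul0r.
rewrite big_ord_recr IH /=; case: ltnP => MN.
  by rewrite (minn_idPl MN) -natr1 mulrDl mul1r.
by rewrite (minn_idPr (leqW MN)) addr0.
Qed.

Lemma esum_pair_le (R : realType) (T1 T2 : choiceType) (f : T1 * T2 -> \bar R)
    (g : T1 -> \bar R) : (forall t, 0 <= f t)%E ->
  (forall x, \esum_(y in setT) f (x, y) <= g x)%E ->
  (\esum_(t in setT) f t <= \esum_(x in setT) g x)%E.
Proof.
move=> f0 fg; have -> : [set: T1 * T2] = [set t | [set: T1] t.1 /\ [set: T2] t.2].
  by apply/seteqP; split.
rewrite (eq_esum (b := fun t => f (t.1, t.2))); last by case.
rewrite -(@esum_esum _ _ _ setT (fun=> setT) (fun x y => f (x, y)))//.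
by apply: le_esum => x _; exact: fg.
Qed.

Lemma esum_geometric_half (R : realType) (c : R) : 0 <= c ->
  (\esum_(i in setT) (c * 2%:R ^- i.+1)%:E <= c%:E)%E.
Proof.
move=> c0; apply: esum_nat_le => [i|N]; first by rewrite mulr_ge0// ltW// pow2N_gt0.
rewrite -mulr_sumr sum_geometric_half -[leRHS]mulr1 ler_wpM2l//.
Qed.

Lemma hausdorff_dim_ge0 (R : realType) (n : nat) (E : set 'rV[R]_n) :
  (0 <= hausdorff_dim E)%E.
Proof. by apply: le_ereal_inf_tmp => _ [s /= [s0 _] <-]; rewrite lee_fin. Qed.

Lemma packing_dim_ge0 (R : realType) (n : nat) (E : set 'rV[R]_n) :
  (0 <= packing_dim E)%E.
Proof. by apply: le_ereal_inf_tmp => _ [s /= [s0 _] <-]; rewrite lee_fin. Qed.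

(** An additive constant [C] contributes [C / r] to the ratio, at most [e] from a scale [M] on that
    does not depend on the ball. *)
Lemma point_K_ratio_le (R : realType) (n : nat) (U : otm) (A : set nat)
    (x : 'rV[R]_n) (s C e : R) : 0 < e -> exists M, forall (b : rat_ball n) (r : nat),
  (M <= r)%N -> ball_set R b x -> (eucl_diam (ball_set R b) <= (2%:R ^- r)%:E)%E ->
  (ball_K R U A b <= (r%:R * s + C)%:E)%E -> (point_K_ratio U A x r <= (s + e)%:E)%E.
Proof.
move=> e0; exists (Num.truncn (C / e)).+1 => b r Mr bx br Kb.
have r0 : 0 < (r%:R : R) by rewrite ltr0n (leq_trans _ Mr).
rewrite /point_K_ratio lee_pdivrMr//.
apply: (@le_trans _ _ (ball_K R U A b)).
  apply: ereal_inf_le_tmp => _ [p pb <-]; exists p => //.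
  by exists b.
apply: le_trans Kb _; rewrite -EFinM lee_fin mulrDl [r%:R * s]mulrC lerD2l.
rewrite mulrC -ler_pdivrMr//; apply: ltW.
by apply: lt_le_trans (Num.Theory.truncnS_gt _) _; rewrite ler_nat.
Qed.

Lemma natinv_small (R : realType) (e : R) : 0 < e -> exists k, (k.+1%:R : R)^-1 < e.
Proof.
move=> e0; exists (Num.truncn e^-1).
by rewrite invf_plt ?posrE//; exact: Num.Theory.truncnS_gt.
Qed.

Lemma ereal_inf_seq (R : realType) (P : R -> Prop) (d : R) :
  ereal_inf [set s%:E | s in P] = d%:E ->
  exists s : nat -> R, forall k, P (s k) /\ s k < d + k.+1%:R^-1.
Proof.
move=> Pd.
suff /choice[s Hs] : forall k : nat, exists s, P s /\ s < d + k.+1%:R^-1 by exists s.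
move=> k; have : (ereal_inf [set s%:E | s in P] < (d + k.+1%:R^-1)%:E)%E.
  by rewrite Pd lte_fin ltrDl invr_gt0.
by move=> /ereal_inf_lt[_ [s Ps <-]]; rewrite lte_fin; exists s.
Qed.

(** * Oracles attaining the dimensions *)

Section Upper.
Variables (R : realType) (n : nat) (U : otm).
Hypothesis n1 : (1 <= n)%N.
Hypothesis optU : optimal R n U.
Implicit Types (E : set 'rV[R]_n) (x : 'rV[R]_n).

(** A covering set of diameter between [2^-(r+3)] and [2^-(r+2)] is enlarged to a rational ball of
    diameter at most [2^-r], but keeps the [s]-th power of its own diameter as weight. *)
Lemma hausdorff_cover (s e : R) (m : nat) E : hausdorff_measure s E = 0%E -> 0 < e ->
  exists (b : nat -> rat_ball n) (r : nat -> nat) (w : nat -> R),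
    [/\ forall i, 0 <= w i, (\esum_(i in setT) (w i)%:E <= e%:E)%E &
     forall x, E x -> exists i, [/\ (m <= r i)%N, ball_set R (b i) x,
      (eucl_diam (ball_set R (b i)) <= (2%:R ^- r i)%:E)%E &
      0 <= s -> (2%:R ^- (r i).+3) `^ s <= w i]].
Proof.
move=> Es e0.
have : (hausdorff_content s E (2%:R ^- m.+2) < e%:E)%E.
  by rewrite (hausdorff_content_eq0 Es (pow2N_gt0 _ _)) lte_fin.
move=> /ereal_inf_lt[_ [D [V [EV Vd ->]]] De].
have Dd i : D i -> eucl_diam (V i) = (fine (eucl_diam (V i)))%:E.
  move=> /Vd /andP[h1 h2]; rewrite fineK// fin_numE gt_eqF ?(lt_trans _ h1)//.
  by rewrite lt_eqF// (le_lt_trans h2)// ltry.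
have /choice[br Hbr] : forall i, exists br : rat_ball n * nat, D i ->
  [/\ (m <= br.2)%N, V i `<=` ball_set R br.1,
    (eucl_diam (ball_set R br.1) <= (2%:R ^- br.2)%:E)%E &
    2%:R ^- br.2.+3 <= fine (eucl_diam (V i))].
  move=> i; have [Di|nDi] := pselect (D i); last by exists (RatBall 0 ltr01, 0%N).
  have := Vd i Di; rewrite (Dd i Di) lte_fin lee_fin => /andP[d0 dm].
  have [r [mr dr rd]] := dyadic_scale d0 dm.
  case: r mr dr rd => [//|[//|r]] mr dr rd.
  have : (0 < eucl_diam (V i))%E by rewrite Dd.
  (* Positive diameter makes the set nonempty, which provides a point to center the ball near. *)
  move=> /ereal_sup_gt[_ [y [_ [Vy _ _]]] _].
  have [b [by_ bd]] := rat_ball_around y r n1.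
  exists (b, r) => _; split=> //=; last exact: ltW.
  move=> x Vx; apply: by_; apply: le_trans dr.
  by rewrite -lee_fin -Dd//; exact: eucl_diam_ge.
exists (fun i => (br i).1), (fun i => (br i).2),
  (fun i => if `[< D i >] then fine (eucl_diam (V i)) `^ s else 0).
split=> [i||x /EV[i Di Vx]].
- by case: ifP => // _; exact: powR_ge0.
- apply/ltW; apply: le_lt_trans De; rewrite [leRHS]esum_mkcond.
  apply: le_esum => i _; case: asboolP => Di; last by rewrite memNset.
  by rewrite mem_set// (Dd i Di).
have [mr Vb bd rd] := Hbr i Di; exists i; split=> //; first exact: Vb.
move=> s0; rewrite asboolT//; apply: ge0_ler_powR => //.
  by rewrite nnegrE ltW// pow2N_gt0.
by rewrite nnegrE; apply: le_trans rd; rewrite ltW// pow2N_gt0.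
Qed.

Lemma hausdorff_dim_attained E : exists A : set nat, forall x, E x ->
  (limn_einf (point_K_ratio U A x) <= hausdorff_dim E)%E.
Proof.
case Ed : (hausdorff_dim E) => [d| |]; last first.
- by have := hausdorff_dim_ge0 E; rewrite Ed.
- by exists set0 => x _; rewrite leey.
have [s Hs] := ereal_inf_seq Ed.
have e0 k m : 0 < (2%:R : R) ^- k.+1 * 2%:R ^- m.+1 by rewrite mulr_gt0// pow2N_gt0.
(* One oracle must serve all exponents [s k] and all scales [m], so the cover for [(k, m)] receives
   total weight at most [2^-(k+1) * 2^-(m+1)]. *)
have /choice[F HF] : forall km : nat * nat,
    exists F : (nat -> rat_ball n) * (nat -> nat) * (nat -> R),
    [/\ forall i, 0 <= F.2 i,
     (\esum_(i in setT) (F.2 i)%:E <= (2%:R ^- km.1.+1 * 2%:R ^- km.2.+1)%:E)%E &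
     forall x, E x -> exists i, [/\ (km.2 <= F.1.2 i)%N, ball_set R (F.1.1 i) x,
      (eucl_diam (ball_set R (F.1.1 i)) <= (2%:R ^- F.1.2 i)%:E)%E &
      0 <= s km.1 -> (2%:R ^- (F.1.2 i).+3) `^ s km.1 <= F.2 i]].
  move=> [k m]; have [b [r [w H]]] := hausdorff_cover m (Hs k).1.2 (e0 k m).
  by exists (b, r, w).
have [||A [c HA]] := @coding_of_summable R n U optU (nat * (nat * nat))%type
  (fun t => (F (t.1, t.2.1)).1.1 t.2.2) (fun t => (F (t.1, t.2.1)).2 t.2.2).
- by move=> t; have [+ _ _] := HF (t.1, t.2.1); apply.
- have pos t : (0 <= ((F (t.1, t.2.1)).2 t.2.2 : R)%:E)%E.
    by rewrite lee_fin; have [+ _ _] := HF (t.1, t.2.1); apply.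
  apply: le_trans (esum_pair_le pos (g := fun k => (1 * 2%:R ^- k.+1)%:E) _) _; last first.
    exact: esum_geometric_half.
  move=> k; rewrite mul1r.
  apply: le_trans (esum_pair_le _ (g := fun m => (2%:R ^- k.+1 * 2%:R ^- m.+1)%:E) _) _; last first.
  + by apply: esum_geometric_half; rewrite ltW// pow2N_gt0.
  + by move=> m; have [_ + _] := HF (k, m).
  + by move=> mi; exact: (pos (k, mi)).
exists A => x Ex; apply/lee_addgt0Pr.
suff H (e : R) : 0 < e -> (limn_einf (point_K_ratio U A x) <= (d + e)%:E)%E by exact: H.
move=> e_gt0.
have e2 : 0 < e / 2%:R by rewrite divr_gt0.
have [k ke] := natinv_small e2.
have [[sk0 _] skd] := Hs k.
(* The constant collects [3 s k] from the scale [r + 3], 1 from rounding the exponent up, and [c]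
   from the coding. *)
have [M HM] := point_K_ratio_le U A x (s k) (3%:R * s k + 1 + c%:R) e2.
apply: (@le_trans _ _ (s k + e / 2%:R)%:E); last by rewrite lee_fin; set eta := _^-1 in ke skd; lra.
apply: limn_einf_le => N.
have [_ _ /(_ x Ex)[i [mr bx br rw]]] := HF (k, maxn N M).
exists ((F (k, maxn N M)).1.2 i); first by apply: leq_trans mr; exact: leq_maxl.
apply: (HM ((F (k, maxn N M)).1.1 i)) => //.
  by apply: leq_trans mr; exact: leq_maxr.
set r := (F _).1.2 i in mr br rw *.
have y0 : 0 <= r.+3%:R * s k by rewrite mulr_ge0.
apply: le_trans (HA (k, (maxn N M, i)) (Num.truncn (r.+3%:R * s k)).+1 _) _ => /=.
  by apply: le_trans (rw sk0); rewrite pow2_powR; exact: pow2_le_powR.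
rewrite lee_fin natrD -natr1.
have : (Num.truncn (r.+3%:R * s k))%:R <= r.+3%:R * s k by rewrite Num.Theory.truncn_le.
have -> : (r.+3%:R : R) = r%:R + 3%:R by rewrite -natrD addn3.
lra.
Qed.

(** Balls of radius [rho] around points more than [2 rho] apart form a packing, so the content
    bounds the number of such points. A largest such set is a [2 rho]-net, as any uncovered point
    could be added. *)
Lemma maximal_separated (s d rho : R) (F : set 'rV[R]_n) : 0 <= s ->
  (packing_content s F d < 1)%E -> 0 < rho <= d ->
  exists (N : nat) (c : nat -> 'rV[R]_n), N%:R * rho `^ s <= 1 /\
    forall x, F x -> exists2 i, (i < N)%N & eucl_dist (c i) x <= rho *+ 2.
Proof.
move=> s0 Fd /andP[rho0 rhod].
have rs0 : 0 < rho `^ s by exact: powR_gt0.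
pose sep N := exists c : nat -> 'rV[R]_n, (forall i, (i < N)%N -> F (c i)) /\
  forall i j, (i < N)%N -> (j < N)%N -> eucl_dist (c i) (c j) <= rho *+ 2 -> i = j.
have sepN N : sep N -> N%:R * rho `^ s <= 1.
  move=> [c [cF csep]]; rewrite -lee_fin; apply: le_trans (ltW Fd).
  apply: (@le_trans _ _ (\esum_(i in `I_N) (eucl_diam (eucl_cball (c i) rho) `^ s))%E).
    apply: esum_ge; exists `I_N; first by split; [exact: finite_II|].
    rewrite -fsbig_ord.
    apply: (@le_trans _ _ (\sum_(i < N) (rho `^ s)%:E)%E).
      by rewrite sumEFin sumr_const card_ord mulr_natl.
    apply: lee_sum => i _; rewrite -poweR_EFin; apply: gt0_ler_poweR => //.
    - by rewrite in_itv /= leey andbT lee_fin ltW.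
    - rewrite in_itv /= leey andbT; apply: le_trans (eucl_diam_cball_ge _ n1 (ltW rho0)).
      by rewrite lee_fin ltW.
    - exact: eucl_diam_cball_ge (ltW rho0).
  apply: ereal_sup_ubound; exists `I_N, c, (fun=> rho); split=> //.
    by move=> i iN; split; [exact: cF|rewrite rho0].
  move=> i j iN jN [z [zi zj]]; apply: csep => //.
  apply: le_trans (eucl_dist_triangle z _ _) _.
  by rewrite mulr2n lerD// eucl_distC.
have sep0 : exists N, `[< sep N >].
  by exists 0%N; apply/asboolP; exists (fun=> 0).
have bound N : `[< sep N >] -> (N <= Num.truncn ((rho `^ s)^-1))%N.
  move=> /asboolP/sepN; rewrite -ler_pdivlMr// mul1r => h.
  by rewrite Num.Theory.truncn_ge_nat ?invr_ge0 ?powR_ge0.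
case: (ex_maxnP sep0 bound) => N /asboolP sN maxN.
have [c [cF csep]] := sN; exists N, c; split; first exact: sepN.
move=> x Fx; apply: contrapT => far.
have far' i : (i < N)%N -> rho *+ 2 < eucl_dist (c i) x.
  by move=> iN; rewrite ltNge; apply/negP => h; apply: far; exists i.
have : sep N.+1.
  exists (fun i => if (i < N)%N then c i else x); split=> [i|i j].
    by rewrite ltnS; case: ltnP => [/cF|].
  rewrite !ltnS; case: (ltnP i N) => [iN _|Ni iN]; case: (ltnP j N) => [jN _|Nj jN].
  - exact: csep.
  - by move=> h; have := far' i iN; rewrite ltNge h.
  - by move=> h; have := far' j jN; rewrite eucl_distC ltNge h.
  - by move=> _; lia.
by move=> /asboolP/maxN; rewrite ltnn.
Qed.

(** Taking [rho = 2^-(r+3)], the covering radius [2 rho = 2^-(r+2)] is the one that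
    [rat_ball_around] absorbs into diameter [2^-r]. *)
Lemma packing_cover (s : R) (F : set 'rV[R]_n) : 0 <= s ->
  (packing_premeasure s F < 1)%E ->
  exists (b : nat -> nat -> rat_ball n) (N : nat -> nat) (r0 : nat), forall r, (r0 <= r)%N ->
    (N r)%:R * (2%:R ^- r.+3) `^ s <= 1 /\
    forall x, F x -> exists2 i, (i < N r)%N & ball_set R (b r i) x /\
      (eucl_diam (ball_set R (b r i)) <= (2%:R ^- r)%:E)%E.
Proof.
move=> s0 /packing_premeasure_lt[d d0 Fd]; have [r0 r0d] := pow2_small d0.
have /choice[bN HbN] : forall r, exists bN : (nat -> rat_ball n) * nat, (r0 <= r)%N ->
    bN.2%:R * (2%:R ^- r.+3) `^ s <= 1 /\
    forall x, F x -> exists2 i, (i < bN.2)%N & ball_set R (bN.1 i) x /\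
      (eucl_diam (ball_set R (bN.1 i)) <= (2%:R ^- r)%:E)%E.
  move=> r; have [r0r|] := boolP (r0 <= r)%N; last by exists (fun=> RatBall 0 ltr01, 0%N).
  have [|N [c [Ns cN]]] := @maximal_separated s d (2%:R ^- r.+3) F s0 Fd.
    rewrite pow2N_gt0 /=; apply: le_trans (ltW r0d).
    by rewrite lef_pV2 ?posrE ?exprn_gt0// ler_eXn2l ?ltr1n//; lia.
  have /choice[b Hb] : forall i, exists b : rat_ball n,
    (forall y, eucl_dist (c i) y <= 2%:R ^- r.+2 -> ball_set R b y) /\
    (eucl_diam (ball_set R b) <= (2%:R ^- r)%:E)%E.
    by move=> i; exact: rat_ball_around.
  exists (b, N) => _; split=> // x /cN[i iN ix]; exists i => //.
  have [h1 h2] := Hb i; split=> //; apply: h1; apply: le_trans ix _.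
  by rewrite [2%:R ^+ r.+3]exprS invfM; lra.
by exists (fun r => (bN r).1), (fun r => (bN r).2), r0.
Qed.

Lemma packing_dim_attained E : exists A : set nat, forall x, E x ->
  (limn_esup (point_K_ratio U A x) <= packing_dim E)%E.
Proof.
case Ed : (packing_dim E) => [d| |]; last first.
- by have := packing_dim_ge0 E; rewrite Ed.
- by exists set0 => x _; rewrite leey.
have [s Hs] := ereal_inf_seq Ed.
have /choice[F HF] : forall k, exists F : nat -> set 'rV[R]_n,
    E `<=` \bigcup_j F j /\ forall j, (packing_premeasure (s k) (F j) < 1)%E.
  by move=> k; exact: packing_measure_cover (Hs k).1.2.
have /choice[G HG] : forall kj : nat * nat,
    exists G : (nat -> nat -> rat_ball n) * (nat -> nat) * nat, forall r, (G.2 <= r)%N ->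
    (G.1.2 r)%:R * (2%:R ^- r.+3) `^ s kj.1 <= 1 /\
    forall x, F kj.1 kj.2 x -> exists2 i, (i < G.1.2 r)%N & ball_set R (G.1.1 r i) x /\
      (eucl_diam (ball_set R (G.1.1 r i)) <= (2%:R ^- r)%:E)%E.
  move=> [k j]; have [b [N [r0 H]]] := packing_cover (Hs k).1.1 ((HF k).2 j).
  by exists (b, N, r0).
(* All scales must be coded at once. The geometric factor [a k ^+ r] makes the weights summable over
   [r] and costs only [r / (k+1)] bits, that is [1 / (k+1)] in the ratio. *)
pose a k : R := 2%:R `^ (- k.+1%:R^-1).
have a0 k : 0 < a k by exact: powR_gt0.
have a1 k : a k < 1.
  rewrite /a powRN invf_lt1 ?powR_gt0//.
  have := @gt0_ltr_powR R (k.+1%:R^-1) _ 1 2%:R.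
  by rewrite powR1 !nnegrE ler01 ler0n ltr1n invr_gt0 ltr0n; apply.
(* For fixed [k], [j] and [r] the last factor sums to at most 1 over the balls, and [1 - a k]
   normalises the geometric series in [r]. *)
pose w (t : nat * (nat * (nat * nat))) : R :=
  let: (k, (j, (r, i))) := t in
  if ((G (k, j)).2 <= r)%N && (i < (G (k, j)).1.2 r)%N then
    2%:R ^- k.+1 * 2%:R ^- j.+1 * (1 - a k) * a k ^+ r * (2%:R ^- r.+3) `^ s k
  else 0.
have c0 k j : 0 <= 2%:R ^- k.+1 * 2%:R ^- j.+1 * (1 - a k).
  by rewrite !mulr_ge0// ?subr_ge0 ltW// pow2N_gt0.
have w0 t : 0 <= w t.
  case: t => k [j [r i]]; rewrite /w; case: ifP => // _.
  by rewrite !mulr_ge0 ?powR_ge0// ?exprn_ge0// ?subr_ge0 ltW// pow2N_gt0.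
have [||A [c HA]] := @coding_of_summable R n U optU (nat * (nat * (nat * nat)))%type
  (fun t => (G (t.1, t.2.1)).1.1 t.2.2.1 t.2.2.2) w => //.
  have pos t : (0 <= (w t)%:E)%E by rewrite lee_fin.
  apply: le_trans (esum_pair_le pos (g := fun k => (1 * 2%:R ^- k.+1)%:E) _) _; last first.
    exact: esum_geometric_half.
  move=> k; rewrite mul1r.
  apply: le_trans (esum_pair_le _ (g := fun j => (2%:R ^- k.+1 * 2%:R ^- j.+1)%:E) _) _; last first.
  - by apply: esum_geometric_half; rewrite ltW// pow2N_gt0.
  - move=> j.
    apply: le_trans (esum_pair_le _
      (g := fun r => (2%:R ^- k.+1 * 2%:R ^- j.+1 * (1 - a k) * a k ^+ r)%:E) _) _; last first.
    + apply: esum_nat_le => [r|M]; first by rewrite mulr_ge0// exprn_ge0// ltW.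
      rewrite -mulr_sumr -[leLHS]mulrA; apply: ler_piMr.
        by rewrite mulr_ge0 ?ltW ?pow2N_gt0.
      by rewrite -opprB mulNr -subrX1 opprB gerBl exprn_ge0// ltW.
    + move=> r; set z := 2%:R ^- k.+1 * _ * _ * _.
      have z0 : 0 <= z by rewrite mulr_ge0// exprn_ge0// ltW.
      rewrite /w; case: leqP => /= [r0r|_]; last by rewrite esum1 ?lee_fin.
      have [h _] := HG (k, j) r r0r.
      apply: le_trans (esum_initial_segment _ (mulr_ge0 z0 (powR_ge0 _ _))) _.
      by rewrite lee_fin mulrCA (le_trans (ler_wpM2l z0 h))// mulr1.
    + by move=> ri; exact: (pos (k, (j, ri))).
  - by move=> jri; exact: (pos (k, jri)).
exists A => x Ex; apply/lee_addgt0Pr.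
suff H (e : R) : 0 < e -> (limn_esup (point_K_ratio U A x) <= (d + e)%:E)%E by exact: H.
move=> e_gt0.
(* One third each for the gap between [s k] and [d], the cost [1 / (k+1)] of the scale, and the
   additive constants. *)
have e3 : 0 < e / 3%:R by rewrite divr_gt0.
have [k ke] := natinv_small e3.
have [[sk0 _] skd] := Hs k.
have [j _ Fx] := (HF k).1 x Ex.
have [Q Qa] : exists Q, 2%:R ^- Q < 1 - a k by apply: pow2_small; rewrite subr_gt0.
set eta := k.+1%:R^-1 in ke skd.
have eta0 : 0 < eta by rewrite invr_gt0.
have [M HM] := point_K_ratio_le U A x (s k + eta)
  (3%:R * s k + (k.+1 + j.+1 + Q + 2)%:R + c%:R) e3.
apply: (@le_trans _ _ (s k + eta + e / 3%:R)%:E); last by rewrite lee_fin; lra.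
apply: (@limn_esup_le _ _ _ (maxn M (G (k, j)).2)) => r.
rewrite geq_max => /andP[Mr r0r].
have [_ /(_ x Fx)[i iN [bx br]]] := HG (k, j) r r0r.
apply: HM br _ => //.
have y0 : 0 <= r.+3%:R * s k by rewrite mulr_ge0.
have z0 : 0 <= r%:R * eta by rewrite mulr_ge0// ltW.
(* The bit costs of the factors of the weight, one by one; [Q] pays for [1 - a k]. *)
pose L := (k.+1 + j.+1 + Q + (Num.truncn (r%:R * eta)).+1 +
  (Num.truncn (r.+3%:R * s k)).+1)%N.
apply: le_trans (HA (k, (j, (r, i))) L _) _.
  have hs : 2%:R ^- (Num.truncn (r.+3%:R * s k)).+1 <= (2%:R ^- r.+3) `^ s k.
    by rewrite pow2_powR; exact: pow2_le_powR.
  have ha : 2%:R ^- (Num.truncn (r%:R * eta)).+1 <= a k ^+ r.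
    apply: le_trans (pow2_le_powR z0) _.
    by rewrite /a -powR_mulrn ?powR_ge0// -powRrM mulNr [eta * _]mulrC.
  have p0 q : 0 <= (2%:R : R) ^- q by rewrite ltW// pow2N_gt0.
  rewrite /w r0r iN /L; move: hs ha.
  move: (Num.truncn _).+1 ((2%:R ^- r.+3) `^ s k) => l1 y hs; move: (Num.truncn _).+1 => l2 ha.
  by rewrite !exprD !invfM !ler_pM ?mulr_ge0// ltW.
have : (Num.truncn (r.+3%:R * s k))%:R <= r.+3%:R * s k by rewrite Num.Theory.truncn_le.
have : (Num.truncn (r%:R * eta))%:R <= r%:R * eta by rewrite Num.Theory.truncn_le.
rewrite /L; move: (Num.truncn (r%:R * eta)) (Num.truncn (r.+3%:R * s k)) => l1 l2.
have -> : (r.+3%:R : R) = r%:R + 3%:R by rewrite -natrD addn3.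
rewrite lee_fin !natrD -[l1.+1%:R]natr1 -[l2.+1%:R]natr1.
lra.
Qed.

End Upper.

(** * Both dimensions as minima *)

Local Open Scope ereal_scope.

Lemma limn_einf_ratio_ge0 (R : realType) (n : nat) (U : otm) (A : set nat)
    (x : 'rV[R]_n) : 0 <= limn_einf (point_K_ratio U A x).
Proof.
rewrite leNgt; apply/negP => /(limn_einf_lt 0)[m _]; apply/negP; rewrite -leNgt.
by rewrite mule_ge0// ?min_length_ge0// lee_fin invr_ge0.
Qed.

(** If the supremum [M] is finite, the exponent [M + e] is admissible with threshold [M + e / 2]. A
    point of [E] and [f >= 0] give [M >= 0], so that this exponent is positive. *)
Lemma ereal_inf_le_sup (R : realType) (T : Type) (E : set T) (f : T -> \bar R)
    (P : R -> Prop) :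
  E !=set0 -> (forall x, 0 <= f x) ->
  (forall s0 s : R, (0 < s0)%R -> (s0 < s)%R -> (forall x, E x -> f x < s0%:E) -> P s) ->
  ereal_inf [set s%:E | s in [set s : R | (0 <= s)%R /\ P s]] <=
    ereal_sup [set f x | x in E].
Proof.
move=> [x0 Ex0] f0 fP; set M := ereal_sup _.
have fM x : E x -> f x <= M by move=> Ex; apply: ereal_sup_ubound; exists x.
have : 0 <= M := le_trans (f0 x0) (fM x0 Ex0).
case: M fM => [M fM M0|_ _|//]; last by rewrite leey.
apply/lee_addgt0Pr => e e0; rewrite -EFinD.
move: (e : R) (e0 : (0 < (e : R))%R) => {e0}e e0.
rewrite lee_fin in M0.
apply: ereal_inf_lbound; exists (M + e)%R => //=; split; first lra.
apply: (fP (M + e / 2)%R); [lra|lra|move=> x /fM h].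
by apply: le_lt_trans h _; rewrite lte_fin; lra.
Qed.

Lemma is_min_attained (R : realType) (T S : Type) (E : set S) (f : T -> S -> \bar R)
    (m : \bar R) :
  (forall t, m <= ereal_sup [set f t x | x in E]) ->
  (exists t, forall x, E x -> f t x <= m) ->
  is_min (fun t => ereal_sup [set f t x | x in E]) m.
Proof.
move=> lb [t ft]; split=> //; exists t; apply/eqP; rewrite eq_le lb andbT.
by apply: ge_ereal_sup => _ [x Ex <-]; exact: ft.
Qed.

Theorem theorem5p5 (R : realType) (n : nat) (hn : (1 <= n)%N) (U : otm)
    (hU : optimal R n U) (E : set 'rV[R]_n) (hE : E !=set0) :
  is_min (fun A : set nat =>
            ereal_sup [set limn_einf (point_K_ratio U A x) | x in E])
         (hausdorff_dim E) /\
  is_min (fun A : set nat =>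
            ereal_sup [set limn_esup (point_K_ratio U A x) | x in E])
         (packing_dim E).
Proof.
have lb (A : set nat) (x : 'rV[R]_n) := limn_einf_ratio_ge0 U A x.
split.
  apply: (is_min_attained (f := fun A x => limn_einf (point_K_ratio U A x))).
    move=> A; apply: ereal_inf_le_sup => [//|x|s0 s s00 s0s Es0]; first exact: lb.
    exact: (hausdorff_measure_eq0_of_einf hn hU.1 s00 s0s Es0).
  exact: hausdorff_dim_attained.
apply: (is_min_attained (f := fun A x => limn_esup (point_K_ratio U A x))).
  move=> A; apply: ereal_inf_le_sup => [//|x|s0 s s00 s0s Es0].
    exact: (le_trans (lb A x) (limn_einf_sup _)).
  exact: (packing_measure_eq0_of_esup hn hU.1 s00 s0s Es0).
exact: packing_dim_attained.
Qed.
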